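(* Let $\lambda\in\mathbb{R}_+=[0,\infty)$, and let the processes $(\mathrm{w}_t)_{t\ge 0}$, $(\mathrm{m}_{\lambda,t})_{t\ge 0}$, $(\mathrm{w}_{\lambda,t})_{t\ge 0}$ and the fundamental solutions $(\mathrm{w}^0_t)_{t\ge0}$, $(\mathrm{m}^0_{\lambda,t})_{t\ge0}$, $(\mathrm{w}^0_{\lambda,t})_{t\ge0}$ be as defined in the context. (i) Assume $\mathrm{w}_0\in\mathcal{P}^0(\mathbb{R})$. Then $$R_{\mathrm{w}_t}(z)=R_{\mathrm{w}_0}(z)+R_{\mathrm{w}^0_t}(z),\qquad t\ge 0,$$ where $R_{\mathrm{w}^0_t}(z)=tz^2$, $t\ge0$. Equivalently, $\mathrm{w}_t=\mathrm{w}_0\boxplus \mathrm{w}^0_t$ for all $t\ge 0$. (ii) Assume $\mathrm{m}_{\lambda,0}\in\mathcal{P}^0(\mathbb{R}_+)$. Then $$R_{\mathrm{m}_{\lambda,t}}(z)=\frac{1}{1-tz}\,R_{\mathrm{m}_{\lambda,0}}\!\left(\frac{z}{1-tz}\right)+R_{\mathrm{m}^0_{\lambda,t}}(z),\qquad t\ge0,$$ where $R_{\mathrm{m}^0_{\lambda,t}}(z)=\lambda t z/(1-tz)$, $t\ge 0$. (iii) Assume $\mathrm{w}_{\lambda,0}\in\mathcal{P}^0_{\mathrm{s}}(\mathbb{R})$. Then, for $t\ge 0$, $$R_{\mathrm{w}_{\lambda,t}}(z)+\frac{(1-\lambda)tz^2}{R_{\mathrm{w}_{\lambda,t}}(z)+1}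 =R_{\mathrm{w}^0_{\lambda,t}}(z)+\frac{(1-\lambda)tz^2}{R_{\mathrm{w}^0_{\lambda,t}}(z)+1} +R_{\mathrm{w}_{\lambda,0}}\!\left(z\sqrt{1-(1-\lambda)\left\{\frac{1}{R_{\mathrm{w}_{\lambda,t}}(z)+1}-\frac{1}{R_{\mathrm{w}_{\lambda,t}}(z)+1-tz^2}\right\}}\right),$$ where $R_{\mathrm{w}^0_{\lambda,t}}(z)=\frac12\left\{-1+tz^2+\sqrt{1+2(2\lambda-1)tz^2+t^2z^4}\right\}$.
   Context: For $S=\mathbb{R}$ or $\mathbb{R}_+$, $\mathcal{P}^0(S)$ is the set of Borel probability measures on $S$ with bounded support, with the weak topology; $\mathcal{P}^0_{\mathrm{s}}(\mathbb{R})$ is the set of symmetric elements of $\mathcal{P}^0(\mathbb{R})$ ($\mu(B)=\mu(-B)$). $\mathbb{C}^+=\{\operatorname{Im}z>0\}$. The Cauchy transform of $\mu\in\mathcal{P}^0(S)$ is $G_\mu(z)=\int_S\frac{\mu(dx)}{z-x}$. Processes: each of the following is a continuous process in $t\in[0,\infty)$ whose Cauchy transforms are a solution, for $t\ge0$ and $z\in\mathbb{C}^+$, of the indicated PDE with initial datum the Cauchy transform of the given initial measure (the initial measures having bounded support). - $(\mathrm{w}_t)_{t\ge0}$, values in $\mathcal{P}^0(\mathbb{R})$: $$\frac{\partial G_{\mathrm{w}_t}(z)}{\partial t}+G_{\mathrm{w}_t}(z)\frac{\partial G_{\mathrm{w}_t}(z)}{\partial z}=0.$$ - $(\mathrm{m}_{\lambda,t})_{t\ge0}$,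 values in $\mathcal{P}^0(\mathbb{R}_+)$: $$\frac{\partial G_{\mathrm{m}_{\lambda,t}}(z)}{\partial t}+\{2zG_{\mathrm{m}_{\lambda,t}}(z)-(1-\lambda)\}\frac{\partial G_{\mathrm{m}_{\lambda,t}}(z)}{\partial z}+G_{\mathrm{m}_{\lambda,t}}(z)^2=0.$$ - $(\mathrm{w}_{\lambda,t})_{t\ge0}$, values in $\mathcal{P}^0_{\mathrm{s}}(\mathbb{R})$: $$\frac{\partial G_{\mathrm{w}_{\lambda,t}}(z)}{\partial t}+\Big(G_{\mathrm{w}_{\lambda,t}}(z)-\frac{1-\lambda}{2z}\Big)\frac{\partial G_{\mathrm{w}_{\lambda,t}}(z)}{\partial z}+\frac{1-\lambda}{2z^2}G_{\mathrm{w}_{\lambda,t}}(z)=0.$$ The processes $\mathrm{w}_{\lambda,t}$ and $\mathrm{m}_{\lambda,t}$ are related by $\mathrm{m}_{\lambda,t}=\mathrm{w}_{\lambda,t}^{(2)}$ when the initial measures match ($\mathrm{m}_{\lambda,0}=\mathrm{w}_{\lambda,0}^{(2)}$), where $\mu^{(2)}$ denotes the push-forward of $\mu$ under $x\mapsto |x|^2$. A superscript $0$ denotes the fundamental solution, i.e. the process started from $\delta_0$. Explicitly, for $t>0$, $\mathrm{w}^0_t(dx)=\frac{1}{2\pi t}\sqrt{4t-x^2}\,1_{[-2\sqrt t,2\sqrt t]}(x)dx$; $\mathrm{m}^0_{\lambda,t}(dx)=\max(0,1-\lambda)\delta_0(dx)+\frac{1}{2\pi t x}\sqrt{(x-x^-)(x^+-x)}\,1_{[x^-,x^+]}(x)dx$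 with $x^\pm=t(1\pm\sqrt\lambda)^2$; and $\mathrm{w}^0_{\lambda,t}$ is the symmetric measure with $(\mathrm{w}^0_{\lambda,t})^{(2)}=\mathrm{m}^0_{\lambda,t}$. The $R$-transform of $\mu$ is $R_\mu(z)=zG_\mu^{\langle-1\rangle}(z)-1$, where $G_\mu^{\langle-1\rangle}$ is the compositional inverse of $G_\mu$ (defined near $z=0$, inverting $G_\mu$ near $\infty$); $R_\mu$ is analytic near $0$ with $R_\mu(0)=0$. (Note the normalization: $R_\mu(z)=\sum_{n\ge1}\kappa_n(\mu)z^n$ with $\kappa_n$ the free cumulants.) The free additive convolution $\mu\boxplus\nu$ is the probability measure with $R_{\mu\boxplus\nu}=R_\mu+R_\nu$. All identities between $R$-transforms are identities of analytic functions in a neighbourhood of $z=0$ (depending on $t$); the square roots are the branches equal to $1$ at $z=0$. *)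

(* Defs.v *)
From HB Require Import structures.
From mathcomp Require Import all_boot all_order all_algebra.
From mathcomp Require Import complex.
From mathcomp Require Import all_classical all_reals all_analysis.

Set Implicit Arguments.
Unset Strict Implicit.
Unset Printing Implicit Defensive.

Import Order.TTheory GRing.Theory Num.Theory.
Import numFieldNormedType.Exports.

Local Open Scope classical_set_scope.
Local Open Scope ring_scope.
Local Open Scope complex_scope.

Section Measures.
Variable R : realType.

Definition borelprob := probability (measurableTypeR R) R.

Implicit Types mu nu : borelprob.

Definition msupport mu : set R :=
  [set x | forall U : set R, open U -> U x -> (0 < mu U)%E].

Definition P0 mu : Prop := bounded_set (msupport mu).

(* A Borel measure on [0, +oo[ is identified with the Borel measure on R that
   it induces, i.e. with one giving no mass to the negative reals. *)
Definition P0_nonneg mu : Prop := P0 mu /\ mu `]-oo, 0[%classic = 0%E.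

Definition P0_sym mu : Prop :=
  P0 mu /\ forall B : set (measurableTypeR R), measurable B ->
             mu B = mu (-%R @` B).

Definition weakly_continuous (mu : R -> borelprob) : Prop :=
  forall f : R -> R, continuous f -> bounded_fun f ->
    {within `[0, +oo[%classic,
      continuous (fun t : R => \int[mu t]_x f x : R)}.

(* The integral of a complex-valued function is taken componentwise. *)
Definition Cauchy mu (z : R[i]) : R[i] :=
  (\int[mu]_x complex.Re (z - x%:C)^-1) +i* (\int[mu]_x complex.Im (z - x%:C)^-1).

(* [g] is a compositional inverse of [Cauchy mu] between a neighbourhood of
   infinity and a punctured neighbourhood of 0.  The second clause determines
   the germ of [g] at 0, since [Cauchy mu] maps neighbourhoods of infinity
   onto punctured neighbourhoods of 0 when [mu] has bounded support. *)
Definition is_Cauchy_inv mu (g : R[i] -> R[i]) : Prop :=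
  (\forall z \near (0 : R[i]^o)^', Cauchy mu (g z) = z) /\
  exists M : R, forall u : R[i], M%:C < `|u| -> g (Cauchy mu u) = u.

Definition Cauchy_inv mu : R[i] -> R[i] :=
  xget (fun=> 0) [set g | is_Cauchy_inv mu g].

(* The value at 0 fills in the removable singularity of z * G^<-1>(z) - 1;
   only the germ at 0 is meaningful. *)
Definition Rtransform mu (z : R[i]) : R[i] :=
  if z == 0 then 0 else z * Cauchy_inv mu z - 1.

Definition is_free_conv mu nu rho : Prop :=
  P0 rho /\
  \forall z \near (0 : R[i]^o),
    Rtransform rho z = Rtransform mu z + Rtransform nu z.

(* Well defined up to equality on Borel sets; the default value [mu] is
   irrelevant for [mu] and [nu] of bounded support. *)
Definition free_conv mu nu : borelprob :=
  xget mu [set rho | is_free_conv mu nu rho].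

Definition measure_equal mu nu : Prop :=
  forall A : set (measurableTypeR R), measurable A -> mu A = nu A.

End Measures.

Section Processes.
Variable R : realType.

(* Derivative at [t] of a function on [0, +oo[; one-sided at t = 0. *)
Definition is_time_derive (f : R -> R[i]) (t : R) (d : R[i]) : Prop :=
  (fun s : R => (f s - f t) / (s - t)%:C : R[i]^o)
    @ within `[0, +oo[%classic t^' --> (d : R[i]^o).

Definition is_cderive (f : R[i] -> R[i]) (z d : R[i]) : Prop :=
  is_derive (z : R[i]^o) 1 (f : R[i]^o -> R[i]^o) d.

(* [E z G Gt Gz] expresses the equation at [z] in terms of the values there
   of the solution and of its derivatives in t and z. *)
Definition solves_pde (E : R[i] -> R[i] -> R[i] -> R[i] -> Prop)
    (mu : R -> borelprob R) : Prop :=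
  forall (t : R) (z : R[i]), 0 <= t -> 0 < complex.Im z ->
    exists Gt Gz : R[i],
      [/\ is_time_derive (fun s => Cauchy (mu s) z) t Gt,
          is_cderive (Cauchy (mu t)) z Gz &
          E z (Cauchy (mu t) z) Gt Gz].

Definition pde_w (z G Gt Gz : R[i]) : Prop := Gt + G * Gz = 0.

Definition pde_m (lambda : R) (z G Gt Gz : R[i]) : Prop :=
  Gt + (2 * z * G - (1 - lambda%:C)) * Gz + G ^+ 2 = 0.

Definition pde_wl (lambda : R) (z G Gt Gz : R[i]) : Prop :=
  Gt + (G - (1 - lambda%:C) / (2 * z)) * Gz
     + (1 - lambda%:C) / (2 * z ^+ 2) * G = 0.

(* The index ranges over [t >= 0]; values at negative times are ignored. *)
Definition is_process (S : borelprob R -> Prop)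
    (E : R[i] -> R[i] -> R[i] -> R[i] -> Prop)
    (mu : R -> borelprob R) : Prop :=
  [/\ forall t, 0 <= t -> S (mu t), weakly_continuous mu & solves_pde E mu].

Definition is_fundamental (S : borelprob R -> Prop)
    (E : R[i] -> R[i] -> R[i] -> R[i] -> Prop)
    (mu : R -> borelprob R) : Prop :=
  is_process S E mu /\ measure_equal (mu 0) (\d_ (0 : measurableTypeR R)).

End Processes.

(* Main.v *)
Require Import Defs.
From HB Require Import structures.
From mathcomp Require Import all_boot all_order all_algebra.
From mathcomp Require Import complex.
From mathcomp Require Import all_classical all_reals all_analysis.
From mathcomp Require Import measurable_realfun ring lra.

(* Each equation is solved by characteristics.  Writing G for the Cauchy
   transform at time 0 and a = 1 - lambda, the characteristic Z_s(z) issued from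
   z at time 0 and the value g_s(z) carried along it are explicit:
     w  : Z = z + s G,                g = G;
     m  : Z = q^2 z - a s q,          g = G / q,     q = 1 + s G;
     wl : Z = z sqrt (q^2 - a s q / z^2),  g = Z G / (z q),  q = 1 + s G / z.
   Bounded support makes Z_s - id Lipschitz with a small constant near infinity,
   and it commutes with conjugation, so a characteristic starting far away in
   the upper half plane stays there up to time t; Gronwall's lemma then gives
   G_t (Z_t z) = g_t z.  By conjugation and continuity this holds for all large
   z, so no identity theorem is needed.  Since g_t maps neighbourhoods of
   infinity onto punctured neighbourhoods of 0, the inverse of G_t at u = g_t z
   is Z_t z, and the formulas for the R-transforms are algebraic identities.
   The identification with the free convolution uses that the Cauchy transform
   near infinity determines the integrals of polynomials, and that polynomials
   boundedly approximate the indicators of half-lines. *)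

Set Implicit Arguments.
Unset Strict Implicit.

Import Order.TTheory GRing.Theory Num.Theory.
Import numFieldNormedType.Exports.

Local Open Scope classical_set_scope.
Local Open Scope ring_scope.
Local Open Scope complex_scope.

(** The formulas for the characteristics come from integrating the source first. For [pde_m] the
    carried value satisfies g' = - g^2, so 1/g = 1/G + s; then Z' = 2 Z g - a is a linear equation,
    solved by q^2 z - a s q. If G solves [pde_wl], the function H with H(z^2) = G(z)/z solves
    [pde_m]; hence Z^2 and g/Z follow the characteristic of [pde_m] issued from z^2, and Z carries a
    square root whose branch is controlled by keeping its argument near 1. The obstacle is that
    [solves_pde] gives derivatives in t and in z separately, at each point, with no joint
    regularity. They combine into a chain rule because Taylor bounds for a Cauchy transform depend
    on the measure only through the distance to a set carrying it. Since the R-transform rests on a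
    chosen inverse, its identities are checked with z as parameter. All factors of Z and g are, far
    out, bounded Lipschitz functions of 1/z, uniformly in time; this class is closed under the
    operations that build them, so the estimates follow the shape of the formulas. *)

Local Notation nc := ComplexField.Normc.normc.

(** * Modulus, real and imaginary parts, principal square root *)

Section ComplexModulus.
Variable R : realType.
Local Notation C := R[i].
Implicit Types x y z : C.

Lemma ReD x y : complex.Re (x + y) = complex.Re x + complex.Re y.
Proof. by case: x y => [a b] [c d]. Qed.

Lemma ImD x y : complex.Im (x + y) = complex.Im x + complex.Im y.
Proof. by case: x y => [a b] [c d]. Qed.

Lemma ReM x y :
  complex.Re (x * y) = complex.Re x * complex.Re y - complex.Im x * complex.Im y.
Proof. by case: x y => [a b] [c d]. Qed.

Lemma ImM x y :
  complex.Im (x * y) = complex.Re x * complex.Im y + complex.Im x * complex.Re y.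
Proof. by case: x y => [a b] [c d]. Qed.

Lemma ReN x : complex.Re (- x) = - complex.Re x. Proof. by case: x. Qed.

Lemma ImN x : complex.Im (- x) = - complex.Im x. Proof. by case: x. Qed.

Lemma ReV x :
  complex.Re x^-1 = complex.Re x / (complex.Re x ^+ 2 + complex.Im x ^+ 2).
Proof. by case: x. Qed.

Lemma ImV x :
  complex.Im x^-1 = - (complex.Im x / (complex.Re x ^+ 2 + complex.Im x ^+ 2)).
Proof. by case: x. Qed.

Lemma complex_eta x : complex.Re x +i* complex.Im x = x. Proof. by case: x. Qed.

Lemma complex_ext x y :
  complex.Re x = complex.Re y -> complex.Im x = complex.Im y -> x = y.
Proof. by case: x y => [a b] [c d] /= -> ->. Qed.

(** The norm of [R[i]] takes values in [R[i]]; estimates use the modulus [nc], with values in the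
    ordered field [R]. *)
Lemma normr_nc x : `|x| = (nc x)%:C. Proof. by case: x. Qed.

Lemma nc_ge0 x : 0 <= nc x. Proof. by case: x => a b; exact: sqrtr_ge0. Qed.

Lemma ncD x y : nc (x + y) <= nc x + nc y. Proof. exact: le_normcD. Qed.

Lemma ncN x : nc (- x) = nc x. Proof. exact: normcN. Qed.

Lemma ncB x y : nc (x - y) <= nc x + nc y. Proof. by rewrite -(ncN y) ncD. Qed.

Lemma nc_distC x y : nc (x - y) = nc (y - x).
Proof. by rewrite -ncN opprB. Qed.

Lemma ncM x y : nc (x * y) = nc x * nc y.
Proof. exact: ComplexField.Normc.normcM. Qed.

Lemma ncV x : nc x^-1 = (nc x)^-1.
Proof. exact: ComplexField.Normc.normcV. Qed.

Lemma ncX x n : nc (x ^+ n) = nc x ^+ n.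
Proof.
elim: n => [|n ih]; first by rewrite !expr0 ComplexField.Normc.normc1.
by rewrite !exprS ncM ih.
Qed.

Lemma nc1 : nc (1 : C) = 1. Proof. exact: ComplexField.Normc.normc1. Qed.

Lemma nc0 : nc (0 : C) = 0. Proof. exact: ComplexField.Normc.normc0. Qed.

Lemma nc_real (a : R) : nc a%:C = `|a|.
Proof. by rewrite /= expr0n addr0 sqrtr_sqr. Qed.

Lemma nc_eq0 x : (nc x == 0) = (x == 0).
Proof.
apply/eqP/eqP => [|->]; last exact: nc0.
exact: ComplexField.Normc.eq0_normc.
Qed.

Lemma nc_gt0 x : (0 < nc x) = (x != 0).
Proof. by rewrite lt_def nc_ge0 andbT nc_eq0. Qed.

Lemma ler_Re_nc x : `|complex.Re x| <= nc x.
Proof. by case: x => a b /=; rewrite -sqrtr_sqr ler_wsqrtr// lerDl sqr_ge0. Qed.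

Lemma ler_Im_nc x : `|complex.Im x| <= nc x.
Proof. by case: x => a b /=; rewrite -sqrtr_sqr ler_wsqrtr// lerDr sqr_ge0. Qed.

Lemma nc_le_ReIm x : nc x <= `|complex.Re x| + `|complex.Im x|.
Proof.
case: x => a b /=; rewrite -(@ler_pXn2r _ 2)// ?nnegrE ?sqrtr_ge0 ?addr_ge0//.
rewrite sqr_sqrtr ?addr_ge0 ?sqr_ge0// sqrrD !real_normK ?num_real//.
by rewrite addrAC lerDl mulrn_wge0// mulr_ge0.
Qed.

Lemma nc_conj x : nc x^* = nc x. Proof. by case: x => a b /=; rewrite sqrrN. Qed.

(** Turns a Lipschitz bound between a point and its conjugate into a bound on imaginary parts; this
    keeps characteristics in the upper half plane. *)
Lemma nc_sub_conj x : nc (x - x^*) = 2 * `|complex.Im x|.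
Proof.
have -> : x - x^* = 'i * (2 * complex.Im x)%:C.
  by apply: complex_ext; rewrite !(ReD, ImD, ReM, ImM, ReN, ImN); case: x => a b /=; ring.
by rewrite ncM nc_real normrM ger0_norm//= expr0n expr1n add0r sqrtr1 mul1r.
Qed.

Lemma ler_ncB x y : nc x - nc y <= nc (x - y).
Proof. by rewrite lerBlDr -{1}(subrK y x) ncD. Qed.

Lemma ler_ncDl x y : nc x - nc y <= nc (x + y).
Proof. by rewrite -(ncN y) -{2}(opprK y) ler_ncB. Qed.

Lemma nc_nat n : nc (n%:R : C) = n%:R.
Proof.
have -> : (n%:R : C) = (n%:R : R)%:C by rewrite rmorph_nat.
by rewrite nc_real ger0_norm.
Qed.

Lemma Re_sqrtc_ge0 x : 0 <= complex.Re (sqrtc x).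
Proof. by case: x => a b; exact: sqrtr_ge0. Qed.

(** The two square roots are opposite and [sqrtc] has nonnegative real part, so a root with positive
    real part is the principal one. *)
Lemma sqrtc_unique x y : y ^+ 2 = x -> 0 < complex.Re y -> sqrtc x = y.
Proof.
move=> yx y0; have /eqP := sqr_sqrtc x.
rewrite -{2}yx eqf_sqr => /orP[/eqP //|/eqP h].
by move: (Re_sqrtc_ge0 x); rewrite h ReN leNgt oppr_lt0 y0.
Qed.

(** The hypothesis excludes the negative real axis, where [sqrtc] does not commute with
    conjugation. *)
Lemma sqrtc_conj x : 0 < complex.Re (sqrtc x) -> sqrtc x^* = (sqrtc x)^*.
Proof.
move=> x0; apply: sqrtc_unique; first by rewrite -rmorphXn/= sqr_sqrtc.
by case: (sqrtc x) x0.
Qed.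

End ComplexModulus.

(** * Componentwise integration over a set of full measure *)

Section ComplexIntegral.
Variable R : realType.
Local Notation C := R[i].
Variables (mu : borelprob R) (D : set (measurableTypeR R)).

Definition cmeasurable (f : R -> C) :=
  measurable_fun [set: measurableTypeR R] (fun x => complex.Re (f x)) /\
  measurable_fun [set: measurableTypeR R] (fun x => complex.Im (f x)).

Definition cbounded (f : R -> C) := exists M : R, forall x, D x -> nc (f x) <= M.

Definition cint (f : R -> C) : C :=
  (\int[mu]_(x in D) complex.Re (f x)) +i* (\int[mu]_(x in D) complex.Im (f x)).

Lemma cmeasurable_cst c : cmeasurable (fun=> c).
Proof. by split; exact: measurable_cst. Qed.

Lemma cmeasurable_real : cmeasurable (fun x => x%:C).
Proof. by split => /=; [exact: measurable_id|exact: measurable_cst]. Qed.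

Lemma cmeasurableD f g : cmeasurable f -> cmeasurable g ->
  cmeasurable (fun x => f x + g x).
Proof.
move=> [f1 f2] [g1 g2]; split; [under eq_fun do rewrite ReD|under eq_fun do rewrite ImD];
exact: measurable_funD.
Qed.

Lemma cmeasurableN f : cmeasurable f -> cmeasurable (fun x => - f x).
Proof.
move=> [f1 f2]; split; [under eq_fun do rewrite ReN|under eq_fun do rewrite ImN];
exact: measurableT_comp.
Qed.

Lemma cmeasurableM f g : cmeasurable f -> cmeasurable g ->
  cmeasurable (fun x => f x * g x).
Proof.
move=> [f1 f2] [g1 g2]; split.
  under eq_fun do rewrite ReM.
  by apply: measurable_funB; exact: measurable_funM.
under eq_fun do rewrite ImM.
by apply: measurable_funD; exact: measurable_funM.
Qed.

Lemma cmeasurableV f : cmeasurable f -> cmeasurable (fun x => (f x)^-1).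
Proof.
move=> [f1 f2].
have h : measurable_fun [set: measurableTypeR R]
    (fun x => (complex.Re (f x) ^+ 2 + complex.Im (f x) ^+ 2)^-1).
  (* On nonnegative reals inversion is the power with exponent -1, including the convention that the
     inverse of 0 is 0. *)
  under eq_fun do rewrite -powR_inv1 ?addr_ge0 ?sqr_ge0//.
  apply: (measurableT_comp (@measurable_powR R (-1))).
  by apply: measurable_funD; exact: measurable_funX.
split.
  by under eq_fun do rewrite ReV; exact: measurable_funM.
under eq_fun do rewrite ImV.
by apply: measurableT_comp => //; exact: measurable_funM.
Qed.

Lemma cmeasurable_resolvent z : cmeasurable (fun x => (z - x%:C)^-1).
Proof.
apply: cmeasurableV; apply: cmeasurableD; first exact: cmeasurable_cst.
exact/cmeasurableN/cmeasurable_real.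
Qed.

Hypothesis mD : measurable D.
Hypothesis muD : mu D = 1%E.

Let integrableRe f : cmeasurable f -> cbounded f ->
  mu.-integrable D (EFin \o (fun x => complex.Re (f x))).
Proof.
move=> [f1 _] [M fM]; apply: measurable_bounded_integrable => //.
- by rewrite -ge0_fin_numE ?measure_ge0// fin_num_measure.
- exact: measurable_funTS.
- exists M; split; first exact: num_real.
  move=> y My x Dx; apply: le_trans (ltW My).
  by apply: le_trans (fM _ Dx); exact: ler_Re_nc.
Qed.

Let integrableIm f : cmeasurable f -> cbounded f ->
  mu.-integrable D (EFin \o (fun x => complex.Im (f x))).
Proof.
move=> [_ f1] [M fM]; apply: measurable_bounded_integrable => //.
- by rewrite -ge0_fin_numE ?measure_ge0// fin_num_measure.
- exact: measurable_funTS.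
- exists M; split; first exact: num_real.
  move=> y My x Dx; apply: le_trans (ltW My).
  by apply: le_trans (fM _ Dx); exact: ler_Im_nc.
Qed.

Let Rintegral_cst1 (c : R) : \int[mu]_(x in D) c = c.
Proof.
by rewrite Rintegral_cst// -[RHS]mulr1; congr (_ * _); exact: (congr1 fine muD).
Qed.

Let integrableZ (a : R) (g : R -> R) : mu.-integrable D (EFin \o g) ->
  mu.-integrable D (EFin \o (fun x => a * g x)).
Proof.
move=> ig; rewrite (_ : _ \o _ = (fun x => a%:E * (EFin \o g) x)%E)//.
exact: integrableZl.
Qed.

Lemma eq_cint f g : (forall x, D x -> f x = g x) -> cint f = cint g.
Proof.
move=> fg; rewrite /cint; congr (_ +i* _); apply: eq_Rintegral => x /set_mem Dx;
by rewrite fg.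
Qed.

Lemma cint_cst c : cint (fun=> c) = c.
Proof. by rewrite /cint !Rintegral_cst1 complex_eta. Qed.

Lemma cintD f g : cmeasurable f -> cmeasurable g -> cbounded f -> cbounded g ->
  cint (fun x => f x + g x) = cint f + cint g.
Proof.
move=> mf mg bf bg; rewrite /cint.
rewrite -[RHS]/((_ + _) +i* (_ + _)); congr (_ +i* _).
  under eq_Rintegral do rewrite ReD.
  by rewrite RintegralD//; exact: integrableRe.
under eq_Rintegral do rewrite ImD.
by rewrite RintegralD//; exact: integrableIm.
Qed.

Lemma cintZ c f : cmeasurable f -> cbounded f ->
  cint (fun x => c * f x) = c * cint f.
Proof.
move=> mf bf; case: c => a b; rewrite /cint.
rewrite -[RHS]/((_ - _) +i* (_ + _)); congr (_ +i* _).
  under eq_Rintegral do rewrite ReM/=.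
  rewrite RintegralB ?RintegralZl//; [exact: integrableIm|exact: integrableRe|..].
  - by apply: integrableZ; exact: integrableRe.
  - by apply: integrableZ; exact: integrableIm.
under eq_Rintegral do rewrite ImM/=.
rewrite RintegralD ?RintegralZl//; [exact: integrableRe|exact: integrableIm|..].
- by apply: integrableZ; exact: integrableIm.
- by apply: integrableZ; exact: integrableRe.
Qed.

Lemma cintB f g : cmeasurable f -> cmeasurable g -> cbounded f -> cbounded g ->
  cint (fun x => f x - g x) = cint f - cint g.
Proof.
move=> mf mg bf [M gM].
rewrite cintD//; last 2 first.
- exact: cmeasurableN.
- by exists M => x /gM; rewrite ncN.
congr (_ + _); rewrite -mulN1r -cintZ//; last by exists M.
by apply: eq_cint => x _; rewrite mulN1r.
Qed.

Lemma cint_conj f : cmeasurable f -> cbounded f ->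
  cint (fun x => (f x)^*) = (cint f)^*.
Proof.
move=> mf bf; rewrite /cint /=; congr (_ +i* _).
  by apply: eq_Rintegral => x _; case: (f x).
rewrite -mulN1r -RintegralZl//; last exact: integrableIm.
by apply: eq_Rintegral => x _; rewrite mulN1r; case: (f x).
Qed.

(* The factor 2 comes from bounding real and imaginary parts separately. *)
Lemma nc_cint f M : cmeasurable f -> (forall x, D x -> nc (f x) <= M) ->
  nc (cint f) <= 2 * M.
Proof.
move=> mf fM; apply: (le_trans (nc_le_ReIm _)); rewrite mulr_natl mulr2n /=.
have bf : cbounded f by exists M.
have intM : mu.-integrable D (EFin \o (fun=> M)).
  exact: finite_measure_integrable_cst.
have bound (g : R -> R) : mu.-integrable D (EFin \o g) ->
    (forall x, D x -> `|g x| <= M) -> `|\int[mu]_(x in D) g x| <= M.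
  move=> ig gM; apply: (le_trans (le_normr_Rintegral _ _)) => //.
  apply: (@le_trans _ _ (\int[mu]_(x in D) M)).
    by apply: le_Rintegral => //; exact: integrable_norm.
  by rewrite Rintegral_cst1.
apply: lerD; apply: bound.
- exact: integrableRe.
- by move=> x /fM; apply: le_trans; exact: ler_Re_nc.
- exact: integrableIm.
- by move=> x /fM; apply: le_trans; exact: ler_Im_nc.
Qed.

End ComplexIntegral.

(** * Bounded support gives a compact interval of full measure *)

Section Concentration.
Variable R : realType.
Implicit Types mu : borelprob R.

(* The complement of the support is covered by countably many null intervals
   with rational end points. *)
Lemma P0_concentrated mu : P0 mu ->
  exists2 M : R, 0 < M & mu `[- M, M]%classic = 1%E.
Proof.
move=> [M0 [_ hM0]]; pose M := `|M0| + 1.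
have M_gt0 : 0 < M by rewrite ltr_wpDl.
exists M => //.
have suppM x : msupport mu x -> `|x| <= M.
  by apply: hM0; rewrite /M (le_lt_trans (ler_norm _))// ltrDl.
pose itv (pq : rat * rat) : set (measurableTypeR R) := `]ratr pq.1, ratr pq.2[%classic.
pose F (k : nat) : set (measurableTypeR R) :=
  if @unpickle (rat * rat)%type k is Some pq then
    if mu (itv pq) == 0%E then itv pq else set0
  else set0.
have mitv pq : measurable (itv pq) by exact: measurable_itv.
have F0 k : mu.-negligible (F k).
  rewrite /F; case: unpickle => [pq|]; last exact: negligible_set0.
  case: ifP => [/eqP h|_]; last exact: negligible_set0.
  exact/negligibleP.
have cov : (~` `[- M, M]%classic : set (measurableTypeR R)) `<=` \bigcup_k F k.
  move=> x /= xM; have nx : ~ msupport mu x.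
    by move=> /suppM; rewrite ler_norml => h; apply: xM; rewrite in_itv.
  have /existsNP[U /not_implyP[oU /not_implyP[Ux /negP]]] := nx.
  rewrite -leNgt => muU.
  have /nbhs_ballP[e /= e0 eU] : nbhs (x : R) U by exact: open_nbhs_nbhs.
  have x1 : x - e < x by rewrite gtrBl.
  have x2 : x < x + e by rewrite ltrDl.
  have [p] := rat_in_itvoo x1; rewrite in_itv/= => /andP[p1 p2].
  have [q] := rat_in_itvoo x2; rewrite in_itv/= => /andP[q1 q2].
  exists (pickle (p, q)); first exact: I.
  rewrite /F pickleK ifT; first by apply/andP; rewrite !bnd_simp p2 q1.
  rewrite eq_le measure_ge0 andbT; apply: (le_trans _ muU).
  apply: le_measure; rewrite ?inE; [exact: mitv|exact: open_measurable|].
  move=> y /andP[]; rewrite !bnd_simp => py yq; apply: eU; rewrite /ball/=.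
  by rewrite ltr_distlC (lt_trans p1 py) (lt_trans yq q2).
have mM : measurable (~` `[- M, M]%classic : set (measurableTypeR R)).
  by apply: measurableC; exact: measurable_itv.
have muC : mu (~` `[- M, M]%classic) = 0%E.
  have nC : mu.-negligible (~` `[- M, M]%classic).
    by apply: (negligibleS cov); exact: negligible_bigcup.
  exact: (proj1 (negligibleP mu mM) nC).
by rewrite -[X in mu X]setCK probability_setC// muC sube0.
Qed.

End Concentration.

(** * Estimates for Cauchy transforms away from a set carrying the measure *)

Section CauchyTransform.
Variable R : realType.
Local Notation C := R[i].
Variables (mu : borelprob R) (D : set (measurableTypeR R)).
Hypothesis mD : measurable D.
Hypothesis muD : mu D = 1%E.

Lemma Rintegral_concentrated (f : R -> R) :
  measurable_fun [set: measurableTypeR R] f ->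
  \int[mu]_x f x = \int[mu]_(x in D) f x.
Proof.
move=> mf; rewrite /Rintegral.
have mfe : measurable_fun [set: measurableTypeR R] (EFin \o f) by exact/measurable_EFinP.
have muC : mu (~` D) = 0%E by rewrite probability_setC// muD subee.
have DE : D = setT `\` ~` D by rewrite setDE setCK setTI.
congr fine; rewrite integralE [RHS]integralE.
congr (_ - _)%E.
  by rewrite (ge0_negligible_integral (N := ~` D)) -?DE//;
    [exact: measurableC|exact: measurable_funepos].
by rewrite (ge0_negligible_integral (N := ~` D)) -?DE//;
    [exact: measurableC|exact: measurable_funeneg].
Qed.

Lemma Cauchy_cint z : Cauchy mu z = cint mu D (fun x => (z - x%:C)^-1).
Proof.
have [h1 h2] := cmeasurable_resolvent z.
by rewrite /Cauchy /cint; congr (_ +i* _); exact: Rintegral_concentrated.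
Qed.

(** Covers two regimes at once: [D] the whole line and [d] at most the height of [z] above it, or
    [D] a compact interval and [d] half the modulus of a large [z]. *)
Definition separated (z : C) (d : R) := 0 < d /\ forall x, D x -> d <= nc (z - x%:C).

(* [Cauchy_deriv] is the derivative of [Cauchy mu] at points away from [D]. *)
Definition Cauchy_deriv (w : C) : C := - cint mu D (fun x => (w - x%:C) ^- 2).

Lemma separated_neq0 z d x : separated z d -> D x -> z - x%:C != 0.
Proof. by move=> [d0 h] /h dx; rewrite -nc_gt0 (lt_le_trans d0). Qed.

Lemma nc_resolvent z d x : separated z d -> D x -> nc (z - x%:C)^-1 <= d^-1.
Proof. by move=> [d0 h] /h dx; rewrite ncV lef_pV2 ?posrE// (lt_le_trans d0). Qed.

Let bounded_resolvent z d : separated z d -> cbounded D (fun x => (z - x%:C)^-1).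
Proof. by move=> h; exists d^-1 => x; exact: nc_resolvent. Qed.

Lemma nc_Cauchy z d : separated z d -> nc (Cauchy mu z) <= 2 / d.
Proof.
move=> h; rewrite Cauchy_cint; apply: nc_cint => //; first exact: cmeasurable_resolvent.
by move=> x; exact: nc_resolvent.
Qed.

Lemma nc_Cauchy_deriv z d : separated z d -> nc (Cauchy_deriv z) <= 2 / d ^+ 2.
Proof.
move=> h; rewrite /Cauchy_deriv ncN; apply: nc_cint => //.
  by under eq_fun do rewrite -exprVn expr2; apply: cmeasurableM; exact: cmeasurable_resolvent.
move=> x Dx; rewrite -exprVn ncX -exprVn lerXn2r ?nnegrE ?nc_ge0//.
  by rewrite invr_ge0 ltW//; case: h.
exact: nc_resolvent h Dx.
Qed.

(** Integrates the identity 1/(z-x) - 1/(w-x) + (z-w)/(w-x)^2 = (z-w)^2 / ((z-x)(w-x)^2). The bound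
    does not depend on [mu], so it is uniform along a family of measures. *)
Lemma Cauchy_second_order z w d d' : separated z d -> separated w d' ->
  nc (Cauchy mu z - Cauchy mu w - (z - w) * Cauchy_deriv w)
    <= 2 * (nc (z - w) ^+ 2 / (d * d' ^+ 2)).
Proof.
move=> hz hw; rewrite !Cauchy_cint /Cauchy_deriv mulrN opprK.
have mr := @cmeasurable_resolvent R.
have mr2 : cmeasurable (fun x => (w - x%:C) ^- 2).
  by under eq_fun do rewrite -exprVn expr2; exact: cmeasurableM.
have br2 : cbounded D (fun x => (w - x%:C) ^- 2).
  exists (d' ^- 2) => x Dx; rewrite -exprVn ncX -exprVn lerXn2r ?nnegrE ?nc_ge0//.
    by rewrite invr_ge0 ltW//; case: hw.
  exact: nc_resolvent hw Dx.
rewrite -cintB//; [|exact: bounded_resolvent hz|exact: bounded_resolvent hw].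
rewrite -cintZ// -cintD//; first last.
- by have [M hM] := br2; exists (nc (z - w) * M) => x /hM h; rewrite ncM ler_wpM2l// nc_ge0.
- exists (d^-1 + d'^-1) => x Dx; rewrite (le_trans (ncB _ _))// lerD//.
    exact: nc_resolvent hz Dx.
  exact: nc_resolvent hw Dx.
- by apply: cmeasurableM => //; exact: cmeasurable_cst.
- by apply: cmeasurableD => //; exact: cmeasurableN.
apply: nc_cint => //.
  apply: cmeasurableD; first by apply: cmeasurableD => //; exact: cmeasurableN.
  by apply: cmeasurableM => //; exact: cmeasurable_cst.
move=> x Dx; have z0 := separated_neq0 hz Dx; have w0 := separated_neq0 hw Dx.
have -> : (z - x%:C)^-1 - (w - x%:C)^-1 + (z - w) * (w - x%:C) ^- 2 =
    (z - w) ^+ 2 * ((z - x%:C)^-1 * (w - x%:C)^-1 ^+ 2).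
  by field; rewrite z0 w0.
rewrite ncM ncX ler_wpM2l ?exprn_ge0 ?nc_ge0// ncM ncX invfM -exprVn.
apply: ler_pM; rewrite ?exprn_ge0 ?nc_ge0 ?(nc_resolvent hz Dx)//.
rewrite lerXn2r ?nnegrE ?nc_ge0 ?(nc_resolvent hw Dx)//.
by rewrite invr_ge0 ltW//; case: hw.
Qed.

(** Since z/(z-x) - 1 = x/(z-x), bounded support gains one power of 1/z. *)
Lemma mul_Cauchy M z d : (forall x, D x -> `|x| <= M) -> separated z d ->
  z * Cauchy mu z - 1 = cint mu D (fun x => x%:C * (z - x%:C)^-1).
Proof.
move=> DM hz; rewrite Cauchy_cint.
have mr := @cmeasurable_resolvent R.
have br := bounded_resolvent hz.
have m1 := cmeasurable_cst (1 : C).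
have m2 := cmeasurableM (cmeasurable_cst z) (mr z).
have b1 : cbounded D (fun=> 1 : C) by exists 1 => x _; rewrite nc1.
have b2 : cbounded D (fun x : R => z * (z - x%:C)^-1).
  by have [M' hM'] := br; exists (nc z * M') => x /hM' h; rewrite ncM ler_wpM2l// nc_ge0.
rewrite -(cint_cst mD muD 1) -cintZ// -cintB//.
by apply: eq_cint => x Dx; have z0 := separated_neq0 hz Dx; field.
Qed.

Lemma nc_mul_Cauchy M z d : (forall x, D x -> `|x| <= M) -> separated z d ->
  nc (z * Cauchy mu z - 1) <= 2 * (M / d).
Proof.
move=> DM hz; rewrite (mul_Cauchy DM hz); apply: nc_cint => //.
  by apply: cmeasurableM; [exact: cmeasurable_real|exact: cmeasurable_resolvent].
move=> x Dx; rewrite ncM nc_real; apply: ler_pM; rewrite ?nc_ge0 ?DM//.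
exact: nc_resolvent hz Dx.
Qed.

Lemma mul_Cauchy_lipschitz M z w d d' : (forall x, D x -> `|x| <= M) ->
  separated z d -> separated w d' ->
  nc (z * Cauchy mu z - w * Cauchy mu w) <= 2 * (M * (nc (z - w) / (d * d'))).
Proof.
move=> DM hz hw.
have -> : z * Cauchy mu z - w * Cauchy mu w =
  (z * Cauchy mu z - 1) - (w * Cauchy mu w - 1) by ring.
rewrite (mul_Cauchy DM hz) (mul_Cauchy DM hw).
have mr z' : cmeasurable (fun x : R => x%:C * (z' - x%:C)^-1).
  by apply: cmeasurableM; [exact: cmeasurable_real|exact: cmeasurable_resolvent].
have br z' e : separated z' e -> cbounded D (fun x : R => x%:C * (z' - x%:C)^-1).
  move=> h; exists (M / e) => x Dx; rewrite ncM nc_real.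
  by apply: ler_pM; rewrite ?nc_ge0 ?DM//; exact: nc_resolvent h Dx.
rewrite -cintB//; [|exact: br hz|exact: br hw].
apply: nc_cint => //; first by apply: cmeasurableD => //; exact: cmeasurableN.
move=> x Dx; have z0 := separated_neq0 hz Dx; have w0 := separated_neq0 hw Dx.
have -> : x%:C * (z - x%:C)^-1 - x%:C * (w - x%:C)^-1 =
    x%:C * ((w - z) * ((z - x%:C)^-1 * (w - x%:C)^-1)) by field; rewrite z0 w0.
rewrite ncM nc_real; apply: ler_pM; rewrite ?nc_ge0 ?DM//.
rewrite ncM nc_distC ler_wpM2l ?nc_ge0// ncM invfM.
by apply: ler_pM; rewrite ?nc_ge0 ?(nc_resolvent hz Dx) ?(nc_resolvent hw Dx).
Qed.

End CauchyTransform.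

Lemma separated_Im {R : realType} (z : R[i]) (d : R) :
  0 < d -> d <= complex.Im z -> separated setT z d.
Proof.
move=> d0 dz; split=> // x _; apply: le_trans dz _.
rewrite (le_trans (ler_norm _))// (le_trans _ (ler_Im_nc _))//.
by rewrite ImD ImN/= subr0.
Qed.

Lemma separated_itv {R : realType} (z : R[i]) (M : R) :
  0 < M -> 2 * M <= nc z -> separated `[- M, M]%classic z (nc z / 2).
Proof.
move=> M0 Mz; split; first by lra.
move=> x /=; rewrite in_itv/= -ler_norml => xM.
by have := ler_ncB z x%:C; rewrite nc_real; lra.
Qed.

(** * Functions bounded and Lipschitz in 1/z near infinity *)

Section NearInfinity.
Variable R : realType.
Local Notation C := R[i].
Variable T : R.
Implicit Types (phi psi : R -> C -> C) (P Q : R -> C -> Prop).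

(** One radius serves all times in [0, T], because a characteristic must stay in the good region
    during the whole interval. *)
Definition near_infty P := exists2 rho : R, 0 < rho &
  forall s z, 0 <= s <= T -> rho <= nc z -> P s z.

(* [phi s (1 / v)] is bounded and Lipschitz in [v] near [v = 0], uniformly in
   [s]. *)
Definition lip_infty phi := exists rho K : R, [/\ 0 < rho, 0 <= K &
  forall s z w, 0 <= s <= T -> rho <= nc z -> rho <= nc w ->
    nc (phi s z) <= K /\ nc (phi s z - phi s w) <= K * nc (z^-1 - w^-1)].

Definition tends1_infty phi :=
  forall e : R, 0 < e -> near_infty (fun s z => nc (phi s z - 1) <= e).

Lemma near_inftyI P Q : near_infty P -> near_infty Q ->
  near_infty (fun s z => P s z /\ Q s z).
Proof.
move=> [r r0 hP] [r' r'0 hQ]; exists (Num.max r r').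
  by rewrite lt_max r0.
by move=> s z hs; rewrite ge_max => /andP[h1 h2]; split; [exact: hP|exact: hQ].
Qed.

Lemma near_infty_imp P Q : (forall s z, 0 <= s <= T -> P s z -> Q s z) ->
  near_infty P -> near_infty Q.
Proof. by move=> PQ [r r0 h]; exists r => // s z hs /(h _ _ hs) /(PQ _ _ hs). Qed.

Lemma near_infty_ge r : near_infty (fun _ z => r <= nc z).
Proof.
exists (Num.max r 1) => [|s z _]; first by rewrite lt_max ltr01 orbT.
by rewrite ge_max => /andP[].
Qed.

Lemma near_infty_neq0 : near_infty (fun _ z => z != 0).
Proof. by exists 1 => // s z _ h; rewrite -nc_gt0 (lt_le_trans _ h). Qed.

Lemma near_infty_lip phi : (exists K, near_infty (fun s z => nc (phi s z) <= K)) ->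
  (exists K rho : R, [/\ 0 < rho, 0 <= K & forall s z w, 0 <= s <= T ->
     rho <= nc z -> rho <= nc w -> nc (phi s z - phi s w) <= K * nc (z^-1 - w^-1)]) ->
  lip_infty phi.
Proof.
move=> [K [r r0 hK]] [K' [r' [r'0 K'0 hK']]].
exists (Num.max r r'), (Num.max K K'); split; first by rewrite lt_max r0.
  by rewrite le_max K'0 orbT.
move=> s z w hs; rewrite !ge_max => /andP[h1 h2] /andP[h3 h4]; split.
  by rewrite le_max hK.
by rewrite (le_trans (hK' _ _ _ hs h2 h4))// ler_wpM2r ?nc_ge0// le_max lexx orbT.
Qed.

Lemma lip_infty_ext phi psi : near_infty (fun s z => phi s z = psi s z) ->
  lip_infty phi -> lip_infty psi.
Proof.
move=> [r r0 h] [r' [K [r'0 K0 hK]]]; exists (Num.max r r'), K; split => //.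
  by rewrite lt_max r0.
move=> s z w hs; rewrite !ge_max => /andP[h1 h2] /andP[h3 h4].
by rewrite -!h//; exact: hK.
Qed.

Lemma tends1_infty_ext phi psi : near_infty (fun s z => phi s z = psi s z) ->
  tends1_infty phi -> tends1_infty psi.
Proof.
move=> h hphi e e0; have := near_inftyI h (hphi _ e0).
by apply: near_infty_imp => s z _ [->].
Qed.

Lemma lip_infty_bounded phi : lip_infty phi ->
  exists2 K, 0 <= K & near_infty (fun s z => nc (phi s z) <= K).
Proof.
move=> [r [K [r0 K0 h]]]; exists K => //; exists r => // s z hs rz.
by have [] := h s z z hs rz rz.
Qed.

Lemma lip_infty_cst c : lip_infty (fun _ _ => c).
Proof.
exists 1, (nc c); split => //; rewrite ?nc_ge0// => s z w _ _ _.
by rewrite subrr nc0 lexx mulr_ge0 ?nc_ge0.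
Qed.

Lemma lip_infty_time : lip_infty (fun s _ => s%:C).
Proof.
exists 1, `|T|; split => // s z w /andP[s0 sT] _ _.
rewrite nc_real subrr nc0 mulr_ge0 ?nc_ge0//; split => //.
by rewrite ger0_norm// (le_trans sT)// ler_norm.
Qed.

Lemma lip_infty_inv : lip_infty (fun _ z => z^-1).
Proof.
exists 1, 1; split => // s z w _ z1 w1; rewrite mul1r; split => //.
by rewrite ncV invf_le1// (lt_le_trans _ z1).
Qed.

Lemma lip_inftyD phi psi : lip_infty phi -> lip_infty psi ->
  lip_infty (fun s z => phi s z + psi s z).
Proof.
move=> [r [K [r0 K0 h]]] [r' [K' [r'0 K'0 h']]].
exists (Num.max r r'), (K + K'); split; rewrite ?addr_ge0 ?lt_max ?r0//.
move=> s z w hs; rewrite !ge_max => /andP[h1 h2] /andP[h3 h4].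
have [a1 a2] := h _ _ _ hs h1 h3; have [b1 b2] := h' _ _ _ hs h2 h4; split.
  by rewrite (le_trans (ncD _ _))// lerD.
by rewrite opprD addrACA mulrDl (le_trans (ncD _ _))// lerD.
Qed.

Lemma lip_inftyM phi psi : lip_infty phi -> lip_infty psi ->
  lip_infty (fun s z => phi s z * psi s z).
Proof.
move=> [r [K [r0 K0 h]]] [r' [K' [r'0 K'0 h']]].
have KK : 0 <= K * K' by rewrite mulr_ge0.
exists (Num.max r r'), (K * K' + K * K'); split; rewrite ?addr_ge0 ?lt_max ?r0//.
move=> s z w hs; rewrite !ge_max => /andP[h1 h2] /andP[h3 h4].
have [a1 a2] := h _ _ _ hs h1 h3; have [b1 b2] := h' _ _ _ hs h2 h4.
have [b3 _] := h' _ _ _ hs h4 h4; split.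
  by rewrite ncM (le_trans (ler_pM _ _ a1 b1)) ?nc_ge0// lerDl.
have -> : phi s z * psi s z - phi s w * psi s w =
  phi s z * (psi s z - psi s w) + (phi s z - phi s w) * psi s w by ring.
rewrite (le_trans (ncD _ _))// [leRHS]mulrDl !ncM lerD//.
  by rewrite -mulrA ler_pM ?nc_ge0.
by rewrite mulrAC ler_pM ?nc_ge0.
Qed.

Lemma lip_inftyN phi : lip_infty phi -> lip_infty (fun s z => - phi s z).
Proof.
move=> h; apply: lip_infty_ext (lip_inftyM (lip_infty_cst (-1)) h).
by exists 1 => // s z _ _; rewrite mulN1r.
Qed.

Lemma lip_infty_lin phi : lip_infty phi ->
  lip_infty (fun s z => 1 + phi s z * z^-1).
Proof.
move=> h; apply: lip_inftyD; first exact: lip_infty_cst.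
by apply: lip_inftyM => //; exact: lip_infty_inv.
Qed.

(** The factors q and p of the characteristics are brought to this form 1 + phi/z with phi
    bounded. *)
Lemma tends1_infty_lin phi : lip_infty phi ->
  tends1_infty (fun s z => 1 + phi s z * z^-1).
Proof.
move=> /lip_infty_bounded[K K0 h] e e0.
have := near_inftyI h (near_inftyI near_infty_neq0 (near_infty_ge (K / e))).
apply: near_infty_imp => s z _ [h1 [z0 h2]].
rewrite addrAC subrr add0r ncM ncV ler_pdivrMr ?nc_gt0// (le_trans h1)//.
by rewrite -ler_pdivrMl// mulrC.
Qed.

Lemma tends1_inftyM phi psi : tends1_infty phi -> tends1_infty psi ->
  tends1_infty (fun s z => phi s z * psi s z).
Proof.
(* The product deviates from 1 by at most e1^2 + 2 e1, which is at most 3 e1 since e1 <= 1, hence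
   below e. *)
move=> h h' e e0; pose e1 := Num.min (e / 4) 1.
have e10 : 0 < e1 by rewrite lt_min divr_gt0 ?ltr01.
have e11 : e1 <= 1 by rewrite ge_min lexx orbT.
have e14 : e1 <= e / 4 by rewrite ge_min lexx.
have := near_inftyI (h _ e10) (h' _ e10); apply: near_infty_imp => s z _ [h1 h2].
have -> : phi s z * psi s z - 1 =
  (phi s z - 1) * (psi s z - 1) + (phi s z - 1) + (psi s z - 1) by ring.
apply: (le_trans (ncD _ _)); apply: (le_trans (lerD (ncD _ _) (lexx _))).
rewrite ncM; have := ler_pM (nc_ge0 _) (nc_ge0 _) h1 h2; rewrite -?expr2 => h3.
have : e1 * e1 <= e1 by rewrite ler_piMr// ltW.
by lra.
Qed.

Lemma tends1_nc_ge phi : tends1_infty phi ->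
  near_infty (fun s z => 2^-1 <= nc (phi s z)).
Proof.
have e0 : 0 < (2^-1 : R) by rewrite invr_gt0.
move=> /(_ _ e0); apply: near_infty_imp => s z _ h.
by have := ler_ncB 1 (phi s z); rewrite nc1 nc_distC; lra.
Qed.

Lemma tends1_neq0 phi : tends1_infty phi -> near_infty (fun s z => phi s z != 0).
Proof.
move=> /tends1_nc_ge; apply: near_infty_imp => s z _ h.
by rewrite -nc_gt0 (lt_le_trans _ h)// invr_gt0.
Qed.

Lemma tends1_inftyV phi : tends1_infty phi -> tends1_infty (fun s z => (phi s z)^-1).
Proof.
move=> h e e0; have e20 : 0 < e / 2 by rewrite divr_gt0.
have := near_inftyI (h _ e20) (near_inftyI (tends1_nc_ge h) (tends1_neq0 h)).
apply: near_infty_imp => s z _ [h1 [h2 h3]].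
have -> : (phi s z)^-1 - 1 = - ((phi s z - 1) * (phi s z)^-1) by field.
rewrite ncN ncM ncV ler_pdivrMr ?nc_gt0// (le_trans h1)//.
by rewrite ler_wpM2l// ltW.
Qed.

Lemma lip_inftyV phi : tends1_infty phi -> lip_infty phi ->
  lip_infty (fun s z => (phi s z)^-1).
Proof.
move=> /tends1_nc_ge [r r0 hr] [r' [K [r'0 K0 h]]].
(* Far out a reciprocal is at most 2; a difference of reciprocals brings in two of them, hence 4
   K. *)
exists (Num.max r r'), (4 * K + 2); split.
- by rewrite lt_max r0.
- by rewrite addr_ge0// mulr_ge0.
move=> s z w hs; rewrite !ge_max => /andP[h1 h2] /andP[h3 h4].
have [_ a2] := h _ _ _ hs h2 h4.
have pos v : r <= nc v -> 0 < nc (phi s v).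
  by move=> /(hr _ _ hs); apply: lt_le_trans; rewrite invr_gt0.
have le2 v : r <= nc v -> nc (phi s v)^-1 <= 2.
  move=> rv; rewrite ncV -[leRHS]invrK lef_pV2 ?posrE ?pos ?invr_gt0//.
  exact: hr.
split; first by rewrite (le_trans (le2 _ h1))// lerDr mulr_ge0.
have -> : (phi s z)^-1 - (phi s w)^-1 =
    - ((phi s z - phi s w) * ((phi s z)^-1 * (phi s w)^-1)).
  by field; rewrite -!nc_gt0 !pos.
rewrite ncN ncM.
apply: (@le_trans _ _ (K * nc (z^-1 - w^-1) * (2 * 2))).
  by apply: ler_pM; rewrite ?nc_ge0// ncM ler_pM ?nc_ge0 ?le2.
rewrite mulrAC ler_wpM2r ?nc_ge0//; lra.
Qed.

(** With r the root, Re p = (Re r)^2 - (Im r)^2, so (Re r)^2 >= Re p >= 1/2. *)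
Lemma Re_sqrtc_near1 (p : C) : nc (p - 1) <= 2^-1 -> 2^-1 <= complex.Re (sqrtc p).
Proof.
move=> hp; set r := sqrtc p.
have r2 : r ^+ 2 = p by exact: sqr_sqrtc.
have r0 : 0 <= complex.Re r := Re_sqrtc_ge0 _.
have : 1 - complex.Re p <= 2^-1.
  apply: le_trans hp; rewrite nc_distC (le_trans _ (ler_Re_nc _))//.
  by rewrite (le_trans _ (ler_norm _))// ReD ReN.
rewrite -r2 expr2 ReM => h1.
have : 4^-1 <= complex.Re r * complex.Re r.
  have := sqr_ge0 (complex.Im r); rewrite expr2; lra.
move=> h2; rewrite leNgt; apply/negP => h3.
have : complex.Re r * complex.Re r < 2^-1 * 2^-1 by apply: ltr_pM.
by lra.
Qed.

Lemma tends1_sqrtc phi : tends1_infty phi ->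
  near_infty (fun s z => 2^-1 <= complex.Re (sqrtc (phi s z))).
Proof.
have e0 : 0 < (2^-1 : R) by rewrite invr_gt0.
move=> /(_ _ e0); apply: near_infty_imp => s z _; exact: Re_sqrtc_near1.
Qed.

(** Factor the difference of squares: the sum of the two roots has real part at least 1. *)
Lemma nc_sqrtcB (p p' : C) : 2^-1 <= complex.Re (sqrtc p) ->
  2^-1 <= complex.Re (sqrtc p') -> nc (sqrtc p - sqrtc p') <= nc (p - p').
Proof.
move=> hp hp'; rewrite -{2}(sqr_sqrtc p) -{2}(sqr_sqrtc p').
have -> : sqrtc p ^+ 2 - sqrtc p' ^+ 2 = (sqrtc p - sqrtc p') * (sqrtc p + sqrtc p').
  by ring.
rewrite ncM ler_peMr ?nc_ge0// (le_trans _ (ler_Re_nc _))//.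
by rewrite (le_trans _ (ler_norm _))// ReD; lra.
Qed.

Lemma tends1_infty_sqrtc phi : tends1_infty phi ->
  tends1_infty (fun s z => sqrtc (phi s z)).
Proof.
move=> h e e0; have := near_inftyI (h _ e0) (tends1_sqrtc h).
apply: near_infty_imp => s z _ [h1 h2]; apply: le_trans h1.
have := @nc_sqrtcB (phi s z) 1 h2; rewrite sqrtc1; apply.
by rewrite /= invf_le1// ler1n.
Qed.

Lemma lip_infty_sqrtc phi : tends1_infty phi -> lip_infty phi ->
  lip_infty (fun s z => sqrtc (phi s z)).
Proof.
move=> h [r' [K [r'0 K0 hK]]]; apply: near_infty_lip.
  exists 2; have := tends1_infty_sqrtc h ltr01; apply: near_infty_imp => s z _ h1.
  by have := ler_ncB (sqrtc (phi s z)) 1; rewrite nc1; lra.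
have [r r0 hr] := tends1_sqrtc h; exists K, (Num.max r r'); split => //.
  by rewrite lt_max r0.
move=> s z w hs; rewrite !ge_max => /andP[h1 h2] /andP[h3 h4].
have [_ a2] := hK _ _ _ hs h2 h4.
by apply: le_trans a2; apply: nc_sqrtcB; exact: hr.
Qed.

End NearInfinity.

(** * Limits of sequences with geometrically small increments *)

Section GeometricLimit.
Variable R : realType.
Local Notation C := R[i].

Lemma le0_geometric (x c : R) : (forall n, x <= c / 2 ^+ n) -> x <= 0.
Proof.
move=> h; rewrite leNgt; apply/negP => x0.
have c0 : 0 < c by have := h 0%N; rewrite expr0 divr1; exact: lt_le_trans.
have [n hn] : exists n : nat, c / x < n%:R.
  by exists (Num.bound (c / x)); rewrite archi_boundP// ltW// divr_gt0.
have := h n; rewrite leNgt => /negP; apply.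
rewrite ltr_pdivrMr ?exprn_gt0// mulrC -ltr_pdivrMr//.
rewrite (lt_le_trans hn)// -natrX ler_nat ltnW// ltn_expl//.
Qed.

(** With d_n = c / 2^n the intervals [x_n - 2 d_n, x_n + 2 d_n] are nested, because d_n = 2 d_(n+1);
    the supremum of their left ends lies in all of them. *)
Lemma real_geometric_limit (x : nat -> R) (c : R) :
  (forall n, `|x n.+1 - x n| <= c / 2 ^+ n) ->
  exists l, forall n, `|x n - l| <= 2 * (c / 2 ^+ n).
Proof.
move=> h; pose d n := c / 2 ^+ n.
have dS n : d n = 2 * d n.+1.
  by rewrite /d exprS; field; rewrite expf_neq0.
have d0 n : 0 <= d n by exact: le_trans (h n).
pose a n := x n - 2 * d n; pose b n := x n + 2 * d n.
have step n : a n <= a n.+1 /\ b n.+1 <= b n.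
  have := h n; rewrite -/(d n) ler_norml /a /b => /andP[h1 h2].
  by have := dS n; split; lra.
have ab n m : a n <= b m.
  have [an bn] : (forall k, a n <= a (n + k)%N) /\ (forall k, b (m + k)%N <= b m).
    split; elim=> [|k ih]; rewrite ?addn0// addnS.
      by apply: le_trans ih _; case: (step (n + k)%N).
    by apply: le_trans ih; case: (step (m + k)%N).
  apply: le_trans (an m) (le_trans _ (bn n)); rewrite addnC /a /b.
  have := d0 (m + n)%N; lra.
have supa : has_sup [set a n | n in setT].
  by split; [exists (a 0%N); exists 0%N|exists (b 0%N) => _ [n _ <-]].
exists (sup [set a n | n in setT]) => n; rewrite -/(d n).
have h1 : a n <= sup [set a n | n in setT].
  by apply: sup_upper_bound => //; exists n.
have h2 : sup [set a n | n in setT] <= b n.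
  by apply: sup_le_ub; [case: supa|move=> _ [m _ <-]].
by move: h1 h2; rewrite /a /b ler_norml => h1 h2; apply/andP; split; lra.
Qed.

Lemma complex_geometric_limit (x : nat -> C) (c : R) :
  (forall n, nc (x n.+1 - x n) <= c / 2 ^+ n) ->
  exists l, forall n, nc (x n - l) <= 4 * (c / 2 ^+ n).
Proof.
move=> h.
have [a ha] : exists l, forall n, `|complex.Re (x n) - l| <= 2 * (c / 2 ^+ n).
  apply: real_geometric_limit => n; apply: le_trans (h n).
  by rewrite (le_trans _ (ler_Re_nc _))// ReD ReN.
have [b hb] : exists l, forall n, `|complex.Im (x n) - l| <= 2 * (c / 2 ^+ n).
  apply: real_geometric_limit => n; apply: le_trans (h n).
  by rewrite (le_trans _ (ler_Im_nc _))// ImD ImN.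
exists (a +i* b) => n; apply: (le_trans (nc_le_ReIm _)).
rewrite ReD ReN ImD ImN /=.
have := ha n; have := hb n; lra.
Qed.

End GeometricLimit.

(** * Local inversion between infinity and 0 *)

Section LocalInversion.
Variable R : realType.
Local Notation C := R[i].
Variables (T : R) (g : R -> C -> C).
Hypothesis lip_g : lip_infty T (fun s z => z * g s z).
Hypothesis tends_g : tends1_infty T (fun s z => z * g s z).

(* Contraction principle for [z |-> z g(z) / u], whose fixed points solve
   [g z = u]. *)
Lemma surjective_near0 s rho : 0 <= s <= T -> exists2 d : R, 0 < d &
  forall u : C, 0 < nc u < d -> exists2 z, rho <= nc z & g s z = u.
Proof.
move=> hs; have [r [K [r0 K0 hK]]] := lip_g.
have [r' r'0 hr'] := tends1_nc_ge tends_g.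
pose r1 := Num.max (Num.max r r') (Num.max rho 1).
have r10 : 0 < r1 by rewrite !lt_max r0.
(* The fixed point lives in the region where |z| >= 1/(2|u|). The first bound places it beyond r1,
   where |z g(z)| >= 1/2 makes it invariant; the second makes the Lipschitz constant 4 K |u| at most
   1/2, the added 1 covering K = 0. *)
exists (Num.min (2 * r1)^-1 (8 * K + 1)^-1) => [|u].
  rewrite lt_min !invr_gt0 mulr_gt0//= ltr_wpDl// mulr_ge0//.
rewrite lt_min => /and3P[u0 ur uK].
have u1 : r1 <= (2 * nc u)^-1.
  rewrite -[leLHS]invrK lef_pV2 ?posrE ?invr_gt0 ?mulr_gt0//.
  by move: ur; rewrite invfM; lra.
have dom v : (2 * nc u)^-1 <= nc v -> [/\ r <= nc v, r' <= nc v & rho <= nc v].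
  move=> /(le_trans u1); rewrite /r1 !ge_max => /andP[/andP[-> ->] /andP[-> _]] //.
pose S (z : C) := z * g s z / u.
have Sdom z : (2 * nc u)^-1 <= nc z -> (2 * nc u)^-1 <= nc (S z).
  move=> /dom[_ h _]; rewrite /S ncM ncV invfM ler_wpM2r ?invr_ge0 ?nc_ge0//.
  exact: hr'.
have Slip z w : (2 * nc u)^-1 <= nc z -> (2 * nc u)^-1 <= nc w ->
    nc (S z - S w) <= nc (z - w) / 2.
  move=> hz hw; have [h1 _ _] := dom _ hz; have [h2 _ _] := dom _ hw.
  have [_ h] := hK _ _ _ hs h1 h2.
  have z0 : 0 < nc z by rewrite (lt_le_trans r0).
  have w0 : 0 < nc w by rewrite (lt_le_trans r0).
  have inv2 v : 0 < nc v -> (2 * nc u)^-1 <= nc v -> nc v^-1 <= 2 * nc u.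
    by move=> v0 hv; rewrite ncV -[leRHS]invrK lef_pV2 ?posrE ?invr_gt0 ?mulr_gt0.
  have e : z^-1 - w^-1 = - ((z - w) * (z^-1 * w^-1)).
    by field; rewrite -!nc_gt0 z0 w0.
  rewrite /S -mulrBl ncM ncV ler_pdivrMr// (le_trans h)//.
  rewrite e ncN ncM ncM.
  apply: (@le_trans _ _ (K * (nc (z - w) * (2 * nc u * (2 * nc u))))).
    rewrite ler_wpM2l// ler_wpM2l ?nc_ge0// ler_pM ?nc_ge0// ?inv2//.
  have -> : K * (nc (z - w) * (2 * nc u * (2 * nc u))) =
    nc (z - w) * (4 * K * nc u) * nc u by ring.
  rewrite ler_wpM2r ?nc_ge0// ler_wpM2l ?nc_ge0//.
  have : nc u * (8 * K + 1) <= 1.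
    by rewrite -ler_pdivlMr ?ltr_wpDl ?mulr_ge0// div1r ltW.
  lra.
pose x n := iter n S u^-1.
have xdom n : (2 * nc u)^-1 <= nc (x n).
  elim: n => [|n ih]; last exact: Sdom.
  rewrite /x /= ncV lef_pV2 ?posrE ?mulr_gt0//; lra.
pose c := nc (x 1%N - x 0%N).
have xstep n : nc (x n.+1 - x n) <= c / 2 ^+ n.
  elim: n => [|n ih]; first by rewrite expr0 divr1.
  apply: (le_trans (Slip _ _ (xdom n.+1) (xdom n))).
  rewrite exprS invfM mulrCA mulrC; lra.
have [l hl] := complex_geometric_limit xstep.
have ldom : (2 * nc u)^-1 <= nc l.
  rewrite -subr_le0; apply: (@le0_geometric _ _ (4 * c)) => n.
  have := hl n; have := ler_ncB (x n) l; have := xdom n; rewrite -mulrA; lra.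
have fix_l : S l = l.
  apply/eqP; rewrite -subr_eq0 -nc_eq0 eq_le nc_ge0 andbT.
  apply: (@le0_geometric _ _ (4 * c)) => n.
  have -> : S l - l = (x n.+1 - l) - (S (x n) - S l) by rewrite /x /=; ring.
  rewrite (le_trans (ncB _ _))//.
  have := hl n.+1; have := Slip _ _ (xdom n) ldom; have := hl n.
  have -> : c / 2 ^+ n.+1 = c / 2 ^+ n / 2 by rewrite exprS; field; rewrite expf_neq0.
  by rewrite -[4 * c / _]mulrA; lra.
exists l; first by have [] := dom _ ldom.
have l0 : l != 0 by rewrite -nc_gt0 (lt_le_trans _ ldom)// invr_gt0 mulr_gt0.
have un0 : u != 0 by rewrite -nc_gt0.
apply: (mulfI l0); have : S l * u = l * u by rewrite fix_l.
by rewrite /S divfK.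
Qed.

(** If g(z) = g(w) with z and w distinct, the Lipschitz bound divided by |z - w| gives |z g(z)| <=
    K/|w|, which is below 1/2 once |w| >= 2 K + 1. *)
Lemma injective_near_infty s : 0 <= s <= T -> exists2 rho : R, 0 < rho &
  forall z w, rho <= nc z -> rho <= nc w -> g s z = g s w -> z = w.
Proof.
move=> hs; have [r [K [r0 K0 hK]]] := lip_g.
have [r' r'0 hr'] := tends1_nc_ge tends_g.
exists (Num.max (Num.max r r') (2 * K + 1)) => [|z w].
  by rewrite !lt_max r0.
rewrite !ge_max => /andP[/andP[z1 z2] z3] /andP[/andP[w1 w2] w3] gzw.
have z0 : 0 < nc z by rewrite (lt_le_trans r0).
have w0 : 0 < nc w by rewrite (lt_le_trans r0).
apply/eqP; rewrite -subr_eq0 -nc_eq0 eq_le nc_ge0 andbT leNgt; apply/negP => zw.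
have [_] := hK _ _ _ hs z1 w1; rewrite gzw -mulrBl ncM.
have -> : z^-1 - w^-1 = - ((z - w) * (z^-1 * w^-1)).
  by field; rewrite -!nc_gt0 z0 w0.
rewrite ncN ncM mulrCA ler_pM2l// ncM !ncV => h.
have := hr' _ _ hs z2; rewrite gzw ncM => h2.
have : 2^-1 <= K * (nc w)^-1.
  apply: (le_trans h2); move: h.
  by rewrite -(ler_pM2l z0); congr (_ <= _); field; rewrite !gt_eqF.
rewrite ler_pdivlMr// ; lra.
Qed.

End LocalInversion.

(** * The R-transform read off at values of the Cauchy transform *)

Section RTransform.
Variable R : realType.
Local Notation C := R[i].
Implicit Types mu : borelprob R.

Lemma near0P (P : C -> Prop) : (\forall z \near (0 : R[i]^o), P z) <->
  exists2 d : R, 0 < d & forall z, nc z < d -> P z.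
Proof.
split=> [/nbhs_ballP[e /= e0 h]|[d d0 h]].
  (* The radius of a ball is an element of [R[i]]; being positive, it is real. *)
  exists (complex.Re e); first by move: e0; rewrite ltcE => /andP[].
  move=> z zd; apply: h; rewrite -ball_normE /= sub0r normrN normr_nc.
  by move: e0; rewrite !ltcE/= => /andP[/eqP -> _]; rewrite eqxx.
apply/nbhs_ballP; exists d%:C; first by rewrite /= ltcR.
move=> z; rewrite -ball_normE /= sub0r normrN normr_nc ltcR; exact: h.
Qed.

Lemma Cauchy_lip_infty mu T : P0 mu ->
  lip_infty T (fun _ z => z * Cauchy mu z) /\
  tends1_infty T (fun _ z => z * Cauchy mu z).
Proof.
move=> /P0_concentrated[M M0 muM].
have mI : measurable (`[- M, M]%classic : set (measurableTypeR R)) by exact: measurable_itv.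
have IM x : (`[- M, M]%classic : set R) x -> `|x| <= M.
  by rewrite /= in_itv/= -ler_norml.
have bound z : 2 * M <= nc z -> nc (z * Cauchy mu z - 1) <= 4 * M / nc z.
  move=> hz; have := nc_mul_Cauchy mI muM IM (separated_itv M0 hz).
  by rewrite invf_div; have := nc_ge0 z; lra.
split; last first.
  move=> e e0; have := near_inftyI (near_infty_ge T (2 * M)) (near_infty_ge T (4 * M / e)).
  apply: near_infty_imp => s z _ [h1 h2]; rewrite (le_trans (bound z h1))//.
  by rewrite ler_pdivrMr ?(lt_le_trans _ h1) ?mulr_gt0// -ler_pdivrMl// mulrC.
apply: near_infty_lip.
  exists 3; exists (2 * M); first by rewrite mulr_gt0.
  move=> _ z _ h1; have := ler_ncB (z * Cauchy mu z) 1; rewrite nc1.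
  have := bound z h1; have : 4 * M / nc z <= 2.
    by rewrite ler_pdivrMr ?(lt_le_trans _ h1) ?mulr_gt0//; lra.
  lra.
exists (8 * M), (2 * M); split; rewrite ?mulr_gt0 ?mulr_ge0 ?ltW// => _ z w _ hz hw.
apply: (le_trans (mul_Cauchy_lipschitz mI muM IM (separated_itv M0 hz) (separated_itv M0 hw))).
have z0 : nc z != 0 by rewrite gt_eqF// (lt_le_trans _ hz)// mulr_gt0.
have w0 : nc w != 0 by rewrite gt_eqF// (lt_le_trans _ hw)// mulr_gt0.
have -> : z^-1 - w^-1 = - ((z - w) * (z^-1 * w^-1)).
  by field; rewrite -!nc_eq0 z0 w0.
rewrite ncN !ncM !ncV le_eqVlt; apply/orP; left; apply/eqP; field.
by rewrite z0 w0.
Qed.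

Lemma Cauchy_conj mu T : P0 mu ->
  near_infty T (fun _ z => Cauchy mu z^* = (Cauchy mu z)^*).
Proof.
move=> /P0_concentrated[M M0 muM].
have mI : measurable (`[- M, M]%classic : set (measurableTypeR R)) by exact: measurable_itv.
exists (2 * M) => [|_ z _ hz]; first by rewrite mulr_gt0.
rewrite !(Cauchy_cint mI muM) -(cint_conj mu mI).
- by apply: eq_cint => x _; rewrite fmorphV rmorphB/= oppr0.
- exact: cmeasurable_resolvent.
- by exists (nc z / 2)^-1 => x; apply: nc_resolvent; exact: separated_itv.
Qed.

(** [Cauchy_inv] is picked by [xget], so an inverse has to be exhibited first; the second clause of
    [is_Cauchy_inv] then fixes whichever one was picked at all values taken far out. *)
Lemma Rtransform_Cauchy mu T : P0 mu -> near_infty T (fun _ z =>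
  Cauchy mu z != 0 /\ Rtransform mu (Cauchy mu z) = z * Cauchy mu z - 1).
Proof.
move=> hmu; have h00 : 0 <= (0 : R) <= 0 by rewrite lexx.
have [lip tends] := Cauchy_lip_infty 0 hmu.
have [r r0 inj] := injective_near_infty (g := fun _ => Cauchy mu) lip tends h00.
have [d d0 surj] := surjective_near0 (g := fun _ => Cauchy mu) lip tends r h00.
pose g u := xget 0 [set z | r <= nc z /\ Cauchy mu z = u].
have gP u : (exists2 z, r <= nc z & Cauchy mu z = u) -> r <= nc (g u) /\ Cauchy mu (g u) = u.
  by move=> [z z1 z2]; exact: (@xgetI _ 0 [set z | r <= nc z /\ Cauchy mu z = u] z).
have invg : is_Cauchy_inv mu g.
  split.
    rewrite /dnbhs /within/=; apply/near0P; exists d => // z zd z0.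
    by have [] := gP z _ => //; apply: surj; rewrite nc_gt0 z0.
  exists r => u; rewrite normr_nc ltcR => /ltW ru.
  have [h1 h2] := gP (Cauchy mu u) (ex_intro2 _ _ u ru erefl).
  exact: inj.
have [_ [M hM]] : is_Cauchy_inv mu (Cauchy_inv mu).
  exact: (@xgetI _ (fun=> 0) [set g | is_Cauchy_inv mu g] g).
have [_ /tends1_neq0 ne0] := Cauchy_lip_infty T hmu.
have := near_inftyI ne0 (near_infty_ge T (M + 1)).
apply: near_infty_imp => s z _ [zG Mz].
have G0 : Cauchy mu z != 0 by apply: contra zG => /eqP ->; rewrite mulr0.
split => //; rewrite /Rtransform (negbTE G0) mulrC hM//.
by rewrite normr_nc ltcR (lt_le_trans _ Mz)// ltrDl.
Qed.

End RTransform.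

(** * One-sided time derivatives and Gronwall's lemma *)

Section TimeDerivative.
Variable R : realType.
Local Notation C := R[i].
Implicit Types f g : R -> C.

(** First-order expansion at [s] among nonnegative times, hence one-sided at 0; this form avoids
    dividing by r - s in the product and chain rules. *)
Definition tderive f (s : R) (d : C) := forall e : R, 0 < e ->
  exists2 a : R, 0 < a & forall r, 0 <= r -> `|r - s| < a ->
    nc (f r - f s - (r - s)%:C * d) <= e * `|r - s|.

Lemma tderive_eq f s d d' : tderive f s d -> d = d' -> tderive f s d'.
Proof. by move=> h <-. Qed.

Lemma tderive_lip f s d : tderive f s d ->
  exists a K : R, [/\ 0 < a, 0 < K & forall r, 0 <= r -> `|r - s| < a ->
    nc (f r - f s) <= K * `|r - s|].
Proof.
move=> /(_ _ ltr01)[a a0 h]; exists a, (1 + nc d); split => //.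
  by rewrite ltr_wpDr// nc_ge0.
move=> r r0 ra; have := h r r0 ra.
have -> : f r - f s = (f r - f s - (r - s)%:C * d) + (r - s)%:C * d by ring.
move=> h1; rewrite (le_trans (ncD _ _))// mulrDl lerD//; first by rewrite addrK in h1.
by rewrite ncM nc_real mulrC.
Qed.

Lemma tderive_continuous f s d e : tderive f s d -> 0 < e ->
  exists2 a : R, 0 < a & forall r, 0 <= r -> `|r - s| < a -> nc (f r - f s) <= e.
Proof.
move=> /tderive_lip[a [K [a0 K0 h]]] e0.
exists (Num.min a (e / K)) => [|r r0]; first by rewrite lt_min a0 divr_gt0.
rewrite lt_min => /andP[ra re]; rewrite (le_trans (h r r0 ra))//.
by rewrite mulrC -ler_pdivlMr// ltW.
Qed.

Lemma tderive_cst c s : tderive (fun=> c) s 0.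
Proof.
move=> e e0; exists 1 => // r _ _.
by rewrite mulr0 subrr subr0 nc0 mulr_ge0// ltW.
Qed.

Lemma tderive_id s : tderive (fun r => r%:C) s 1.
Proof.
move=> e e0; exists 1 => // r _ _.
have -> : r%:C - s%:C - (r - s)%:C * 1 = 0 :> C by rewrite mulr1 rmorphB subrr.
by rewrite nc0 mulr_ge0// ltW.
Qed.

Lemma tderiveD f g s d d' : tderive f s d -> tderive g s d' ->
  tderive (fun r => f r + g r) s (d + d').
Proof.
move=> h h' e e0; have e20 : 0 < e / 2 by rewrite divr_gt0.
have [a a0 ha] := h _ e20; have [b b0 hb] := h' _ e20.
exists (Num.min a b) => [|r r0]; first by rewrite lt_min a0.
rewrite lt_min => /andP[ra rb].
have -> : f r + g r - (f s + g s) - (r - s)%:C * (d + d') =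
  (f r - f s - (r - s)%:C * d) + (g r - g s - (r - s)%:C * d') by ring.
rewrite (le_trans (ncD _ _))//; have := ha r r0 ra; have := hb r r0 rb; lra.
Qed.

Lemma tderiveM f g s d d' : tderive f s d -> tderive g s d' ->
  tderive (fun r => f r * g r) s (d * g s + f s * d').
Proof.
move=> h h' e e0; have [a1 [K [a10 K0 h1]]] := tderive_lip h.
have e1p : 0 < e / 3 / (nc (g s) + 1) by rewrite !divr_gt0// ltr_wpDl ?nc_ge0.
have e2p : 0 < e / 3 / (nc (f s) + 1) by rewrite !divr_gt0// ltr_wpDl ?nc_ge0.
have e3p : 0 < e / 3 / K by rewrite !divr_gt0.
have [a2 a20 h2] := h _ e1p; have [a3 a30 h3] := h' _ e2p.
have [a4 a40 h4] := tderive_continuous h' e3p.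
exists (Num.min (Num.min a1 a2) (Num.min a3 a4)) => [|r r0].
  by rewrite !lt_min a10 a20 a30 a40.
rewrite !lt_min => /andP[/andP[ra1 ra2] /andP[ra3 ra4]].
have -> : f r * g r - f s * g s - (r - s)%:C * (d * g s + f s * d') =
  (f r - f s - (r - s)%:C * d) * g s + f s * (g r - g s - (r - s)%:C * d')
  + (f r - f s) * (g r - g s) by ring.
have scale (x y c : R) : 0 <= c -> 0 <= y -> x <= e / 3 / (c + 1) * y -> x * c <= e / 3 * y.
  move=> c0 y0 hx; apply: (le_trans (ler_wpM2r c0 hx)).
  have c1 : 0 < c + 1 by rewrite ltr_wpDl.
  have -> : e / 3 / (c + 1) * y * c = e / 3 * y * (c / (c + 1)).
    by field; rewrite gt_eqF.
  rewrite ler_piMr// ?mulr_ge0 ?divr_ge0 ?(ltW e0)//.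
  by rewrite ler_pdivrMr// mul1r lerDl.
have B1 := scale _ _ _ (nc_ge0 (g s)) (normr_ge0 _) (h2 r r0 ra2).
have B2 := scale _ _ _ (nc_ge0 (f s)) (normr_ge0 _) (h3 r r0 ra3).
have B3 : nc (f r - f s) * nc (g r - g s) <= e / 3 * `|r - s|.
  apply: (le_trans (ler_pM (nc_ge0 _) (nc_ge0 _) (h1 r r0 ra1) (h4 r r0 ra4))).
  by rewrite le_eqVlt; apply/orP; left; apply/eqP; field; rewrite gt_eqF.
apply: (le_trans (ncD _ _)); apply: (le_trans (lerD (ncD _ _) (lexx _))).
rewrite !ncM; lra.
Qed.

Lemma tderiveN f s d : tderive f s d -> tderive (fun r => - f r) s (- d).
Proof.
move=> h; have := tderiveM (tderive_cst (-1) s) h.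
rewrite mul0r add0r mulN1r => h' e /h'[a a0 ha]; exists a => // r r0 ra.
by have := ha r r0 ra; rewrite !mulN1r.
Qed.

Lemma tderiveV f s d : f s != 0 -> tderive f s d ->
  tderive (fun r => (f r)^-1) s (- d / f s ^+ 2).
Proof.
move=> fs0 h e e0; have F0 : 0 < nc (f s) by rewrite nc_gt0.
pose F := nc (f s).
(* The error has denominator f(s)^2 f(r), of modulus at least F^3/2 near s, so each of the two terms
   of its numerator may cost e F^3/4 times |r - s|. *)
have e1p : 0 < e * F ^+ 2 / 4 by rewrite divr_gt0// mulr_gt0// exprn_gt0.
have e2p : 0 < e * F ^+ 3 / 4 / (nc d + 1).
  by rewrite !divr_gt0// ?mulr_gt0 ?exprn_gt0// ltr_wpDl ?nc_ge0.
have e3p : 0 < F / 2 by rewrite divr_gt0.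
have [a1 a10 h1] := h _ e1p; have [a2 a20 h2] := tderive_continuous h e2p.
have [a3 a30 h3] := tderive_continuous h e3p.
exists (Num.min a1 (Num.min a2 a3)) => [|r r0]; first by rewrite !lt_min a10 a20.
rewrite !lt_min => /and3P[ra1 ra2 ra3].
have Fr : F / 2 <= nc (f r).
  by have := h3 r r0 ra3; have := ler_ncB (f s) (f r); rewrite nc_distC /F; lra.
have fr0 : f r != 0 by rewrite -nc_gt0 (lt_le_trans _ Fr).
have -> : (f r)^-1 - (f s)^-1 - (r - s)%:C * (- d / f s ^+ 2) =
  (- (f s * (f r - f s - (r - s)%:C * d)) + (r - s)%:C * (d * (f r - f s))) /
  (f s ^+ 2 * f r) by field; rewrite fs0 fr0.
have den : F ^+ 3 / 2 <= nc (f s ^+ 2 * f r).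
  by rewrite ncM ncX -/F exprSr -mulrA ler_wpM2l// exprn_ge0// ltW.
rewrite ncM ncV ler_pdivrMr; last by rewrite (lt_le_trans _ den)// divr_gt0// exprn_gt0.
have B1 : nc (f s) * nc (f r - f s - (r - s)%:C * d) <= e * F ^+ 3 / 4 * `|r - s|.
  apply: (le_trans (ler_wpM2l (nc_ge0 _) (h1 r r0 ra1))); rewrite -/F.
  by rewrite le_eqVlt; apply/orP; left; apply/eqP; ring.
have B2 : nc d * nc (f r - f s) <= e * F ^+ 3 / 4.
  apply: (le_trans (ler_wpM2l (nc_ge0 _) (h2 r r0 ra2))).
  rewrite mulrCA ler_piMr//; first by rewrite divr_ge0// mulr_ge0 ?exprn_ge0 ?ltW.
  by rewrite ltW// ltr_pdivrMr ?ltr_wpDl ?nc_ge0// mul1r ltrDl.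
apply: (@le_trans _ _ (e * `|r - s| * (F ^+ 3 / 2))); last first.
  by rewrite ler_wpM2l// mulr_ge0// ltW.
apply: (le_trans (ncD _ _)); rewrite ncN !ncM nc_real.
have := ler_wpM2l (normr_ge0 (r - s)) B2; lra.
Qed.

(** At nearby times p moves by at most another 1/4, so it stays within 1/2 of 1, where both roots
    have real part at least 1/2 and no branch is crossed. *)
Lemma tderive_sqrtc p s d : nc (p s - 1) <= 4^-1 -> tderive p s d ->
  tderive (fun r => sqrtc (p r)) s (d / (2 * sqrtc (p s))).
Proof.
move=> ps h e e0.
have e1p : 0 < e / 2 by rewrite divr_gt0.
have e2p : 0 < e / 2 / (nc d + 1) by rewrite !divr_gt0// ltr_wpDl ?nc_ge0.
have e3p : 0 < (4^-1 : R) by rewrite invr_gt0.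
have [a1 a10 h1] := h _ e1p; have [a2 a20 h2] := tderive_continuous h e2p.
have [a3 a30 h3] := tderive_continuous h e3p.
exists (Num.min a1 (Num.min a2 a3)) => [|r r0]; first by rewrite !lt_min a10 a20.
rewrite !lt_min => /and3P[ra1 ra2 ra3].
set v := sqrtc (p r); set w := sqrtc (p s).
have hw : 2^-1 <= complex.Re w by apply: Re_sqrtc_near1; lra.
have hv : 2^-1 <= complex.Re v.
  apply: Re_sqrtc_near1; have -> : p r - 1 = (p r - p s) + (p s - 1) by ring.
  by have := ncD (p r - p s) (p s - 1); have := h3 r r0 ra3; lra.
have ncw : 2^-1 <= nc w by rewrite (le_trans hw)// (le_trans (ler_norm _))// ler_Re_nc.
have ncvw : 1 <= nc (v + w).
  by rewrite (le_trans _ (ler_Re_nc _))// (le_trans _ (ler_norm _))// ReD; lra.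
have vw : nc (v - w) <= nc (p r - p s) by apply: nc_sqrtcB.
have w0 : w != 0 by rewrite -nc_gt0 (lt_le_trans _ ncw)// invr_gt0.
have vw0 : v + w != 0 by rewrite -nc_gt0 (lt_le_trans _ ncvw).
have pr : p r = v ^+ 2 by rewrite sqr_sqrtc.
have psE : p s = w ^+ 2 by rewrite sqr_sqrtc.
have -> : v - w - (r - s)%:C * (d / (2 * w)) =
  (2 * w * (p r - p s - (r - s)%:C * d) - (r - s)%:C * (d * (v - w))) /
  (2 * w * (v + w)).
  by rewrite pr psE; field; rewrite vw0 w0.
have B1 := h1 r r0 ra1.
have B2 : nc d * nc (v - w) <= e / 2.
  apply: (le_trans (ler_wpM2l (nc_ge0 _) (le_trans vw (h2 r r0 ra2)))).
  rewrite mulrCA ler_piMr ?(ltW e1p)// ltW//.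
  by rewrite ltr_pdivrMr ?ltr_wpDl ?nc_ge0// mul1r ltrDl.
have n2w : 1 <= nc (2 * w) by rewrite ncM nc_nat; lra.
have n2w0 : 0 < nc (2 * w) by rewrite (lt_le_trans ltr01).
move: (2 * w) n2w n2w0 => W n2w n2w0.
rewrite ncM ncV ler_pdivrMr; last by rewrite ncM mulr_gt0// (lt_le_trans ltr01).
apply: (le_trans (ncB _ _)); rewrite !ncM nc_real.
apply: (@le_trans _ _ (e * `|r - s| * nc W)); last first.
  by rewrite mulrA ler_peMr// !mulr_ge0 ?nc_ge0// ltW.
have B3 := ler_wpM2l (nc_ge0 W) B1.
have B4 := ler_wpM2l (normr_ge0 (r - s)) B2.
have B5 : `|r - s| * (e / 2) <= `|r - s| * (e / 2) * nc W.
  by rewrite ler_peMr// mulr_ge0// ltW.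
lra.
Qed.

Lemma is_time_derive_tderive f s d : is_time_derive f s d -> tderive f s d.
Proof.
move=> h e e0.
have ec0 : 0 < (e%:C : C) by rewrite ltcR.
have /nbhs_ballP[a /= a0 ha] : nbhs s (fun r => r != s -> `[0, +oo[%classic r ->
    `|d - (f r - f s) / (r - s)%:C| <= e%:C).
  exact: (proj1 (cvgrPdist_le _ _) h _ ec0).
exists a => // r r0 ra; have [->|rs] := eqVneq r s.
  by rewrite !subrr mul0r subr0 nc0 normr0 mulr0.
have := ha r; rewrite /ball /= distrC => /(_ ra rs); rewrite /= in_itv/= r0 => /(_ isT).
rewrite normr_nc lecR => h1.
have rs0 : (r - s)%:C != 0 :> C by rewrite -nc_eq0 nc_real normr_eq0 subr_eq0.
have -> : f r - f s - (r - s)%:C * d =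
  - ((d - (f r - f s) / (r - s)%:C) * (r - s)%:C).
  by move: (r - s)%:C rs0 => k k0; field.
by rewrite ncN ncM nc_real ler_wpM2r.
Qed.

(* Freezing [f] at [f 0] for negative times makes the one-sided derivative at
   time 0 two-sided when it vanishes. *)
Lemma tderive_is_derive (p : C -> R) f s d :
  (forall x y, p (x - y) = p x - p y) -> (forall (a : R) x, p (a%:C * x) = a * p x) ->
  (forall x, `|p x| <= nc x) ->
  0 <= s -> (s = 0 -> d = 0) -> tderive f s d ->
  is_derive s 1 (fun r => p (f (Num.max r 0))) (p d).
Proof.
move=> pB pZ p_le s0 sd h.
have lim_p : (fun k : R => k^-1 *:
    (p (f (Num.max (k *: 1 + s) 0)) - p (f (Num.max s 0)))) @ 0^' --> p d.
  apply/cvgrPdist_le => e e0; have [a a0 ha] := h _ e0.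
  pose b := if s == 0 then a else Num.min a s.
  have b0 : 0 < b by rewrite /b; case: eqVneq => // sn; rewrite lt_min a0 lt_def sn.
  rewrite /dnbhs /within /=; apply/nbhs_ballP; exists b => //= k.
  rewrite /ball/= sub0r normrN => kb k0.
  rewrite /GRing.scale/= mulr1 (max_idPl s0).
  have [ks|ks] := leP (k + s) 0; last first.
    have ka : `|k + s - s| < a.
      by rewrite addrK (lt_le_trans kb)// /b; case: ifP => // _; rewrite ge_min lexx.
    have := ha _ (ltW ks) ka; rewrite addrK => h1.
    have h2 := le_trans (p_le _) h1; rewrite !pB pZ in h2.
    have -> : p d - k^-1 * (p (f (k + s)) - p (f s)) =
      - ((p (f (k + s)) - p (f s) - k * p d) / k) by field.
    by rewrite normrN normrM normfV ler_pdivrMr ?normr_gt0.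
  have sE : s = 0.
    apply/eqP; case: (eqVneq s 0) => // sn; move: kb; rewrite /b (negbTE sn) lt_min.
    move=> /andP[_]; rewrite ltr_norml => /andP[h1 _]; lra.
  have p0 : p 0 = 0 by rewrite -(subrr 0) pB subrr.
  by rewrite sE sd// p0 subrr mulr0 subrr normr0 ltW.
by apply: DeriveDef; [apply/cvg_ex; exists (p d)|apply: cvg_lim].
Qed.

(** The function |f(s)|^2 exp(-2 K s) is nonincreasing and vanishes at 0. The bound at time 0 forces
    the derivative there to vanish, which allows the two-sided extension. *)
Lemma gronwall (f : R -> C) (T K : R) :
  (forall s : R, 0 <= s <= T -> exists2 d, tderive f s d & nc d <= K * nc (f s)) ->
  f 0 = 0 -> forall s : R, 0 <= s <= T -> f s = 0.
Proof.
move=> hf f0 s /andP[s0 sT].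
pose u (r : R) : R := complex.Re (f (Num.max r 0)).
pose v (r : R) : R := complex.Im (f (Num.max r 0)).
pose E (r : R) : R := expR (- (2 * K) * r).
pose N : R -> R := (u * u + v * v) * E.
have K0 r : 0 <= r <= T -> exists2 d, [/\ is_derive r (1 : R) u (complex.Re d) &
    is_derive r (1 : R) v (complex.Im d)] & nc d <= K * nc (f r).
  move=> /[dup] hr /hf[d hd Kd]; have [r0 _] := andP hr.
  have d0 : r = 0 -> d = 0.
    move=> rE; apply/eqP; rewrite -nc_eq0 eq_le nc_ge0 andbT (le_trans Kd)//.
    by rewrite rE f0 nc0 mulr0.
  exists d => //; split; apply: tderive_is_derive hd => //.
  - by move=> x y; rewrite ReD ReN.
  - by move=> a x; rewrite ReM/= mul0r subr0.
  - exact: ler_Re_nc.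
  - by move=> x y; rewrite ImD ImN.
  - by move=> a x; rewrite ImM/= mul0r addr0.
  - exact: ler_Im_nc.
have dN r : 0 <= r <= T -> derivable N r 1 /\ derive1 N r <= 0.
  move=> /[dup] hr /K0[d [du dv] Kd]; have [r0 _] := andP hr.
  have de : is_derive r (1 : R) E (- (2 * K) * expR (- (2 * K) * r)).
    have dg : is_derive r (1 : R) ((- (2 * K)) \*: (id : R -> R)) (- (2 * K)).
      by apply: is_derive_eq; rewrite /GRing.scale/= mulr1.
    rewrite mulrC; exact: (is_derive1_comp (is_derive_expR (- (2 * K) * r)) dg).
  have dNr := is_deriveM (is_deriveD (is_deriveM du du) (is_deriveM dv dv)) de.
  split; first exact: ex_derive.
  rewrite derive1E derive_val /GRing.scale/= -/(E r).
  have E0 : 0 <= E r := expR_ge0 _.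
  have fr : nc (f r) ^+ 2 = u r * u r + v r * v r.
    rewrite /u /v (max_idPl r0); case: (f r) => x y /=.
    by rewrite sqr_sqrtr ?addr_ge0 ?sqr_ge0// !expr2.
  have : u r * complex.Re d + v r * complex.Im d <= K * (u r * u r + v r * v r).
    have -> : u r * complex.Re d + v r * complex.Im d = complex.Re ((f r)^* * d).
      by rewrite /u /v (max_idPl r0) ReM; case: (f r) => x y /=; ring.
    rewrite (le_trans (ler_norm _))// (le_trans (ler_Re_nc _))// ncM nc_conj.
    by rewrite -fr expr2 mulrCA ler_wpM2l ?nc_ge0.
  move=> /(ler_wpM2r E0) h.
  rewrite -[(u * u + v * v) r]/(u r * u r + v r * v r).
  lra.
have cN : {within `[0, T]%classic, continuous N}.
  by apply: derivable_within_continuous => r; rewrite in_itv/= => /dN[].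
have Ns : N s <= N 0.
  apply: (ler0_derive1_le_cc _ _ cN) => //.
  - by move=> r; rewrite in_itv/= => /andP[r1 r2]; case: (dN r) => //; rewrite !ltW.
  - by move=> r; rewrite in_itv/= => /andP[r1 r2]; case: (dN r) => //; rewrite !ltW.
  - by rewrite in_itv/= s0.
  - by rewrite in_itv/= lexx (le_trans s0).
have N0 : N 0 = 0.
  by rewrite /N /u /v -[LHS]/((_ * _ + _ * _) * _) maxxx f0 /= !mul0r addr0 mul0r.
have : nc (f s) ^+ 2 * E s <= 0.
  have -> : nc (f s) ^+ 2 * E s = N s.
    rewrite /N -[RHS]/((_ * _ + _ * _) * _); congr (_ * _).
    rewrite /u /v (max_idPl s0); case: (f s) => x y /=.
    by rewrite sqr_sqrtr ?addr_ge0 ?sqr_ge0// !expr2.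
  by rewrite -N0.
rewrite pmulr_lle0 ?expR_gt0// => h; apply/eqP; rewrite -nc_eq0 -sqrf_eq0.
by rewrite eq_le h sqr_ge0.
Qed.

End TimeDerivative.

(** * Chain rule along a moving point and the method of characteristics *)

Section Characteristics.
Variable R : realType.
Local Notation C := R[i].

Let muT (mu : borelprob R) : mu setT = 1%E. Proof. exact: probability_setT. Qed.
Let mT : measurable ([set: measurableTypeR R] : set (measurableTypeR R)).
Proof. exact: measurableT. Qed.

Lemma complex_eq_eps (x y : C) (c : R) : 0 < c ->
  (forall e : R, 0 < e -> nc (x - y) <= c * e) -> x = y.
Proof.
move=> c0 h; apply/eqP; rewrite -subr_eq0 -nc_eq0 eq_le nc_ge0 andbT.
apply/ler_addgt0Pr => e e0; rewrite add0r.
by have := h (e / c) (divr_gt0 e0 c0); rewrite mulrC divfK// gt_eqF.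
Qed.

(** Real increments suffice to identify the derivative, and they keep the distance to the real
    line. *)
Lemma is_cderive_Cauchy (mu : borelprob R) (z d : C) : 0 < complex.Im z ->
  is_cderive (Cauchy mu) z d -> d = Cauchy_deriv mu setT z.
Proof.
move=> z0 [dz dv]; set D := Cauchy_deriv mu setT z.
have lim_d : (fun h : R[i]^o => h^-1 *: ((Cauchy mu (h *: (1 : R[i]^o) + z) : R[i]^o)
    - Cauchy mu z)) @ (0 : R[i]^o)^' --> (d : R[i]^o) by rewrite -dv; exact: dz.
pose y := complex.Im z.
have sep (k : R) : separated setT (z + k%:C) y.
  by apply: separated_Im => //; rewrite ImD/= addr0.
have sepz : separated setT z y by apply: separated_Im.
have y3 : 0 < 2 / y ^+ 3 by rewrite divr_gt0// exprn_gt0.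
apply: (@complex_eq_eps _ _ (1 + 2 / y ^+ 3)); first by rewrite addr_gt0.
move=> e e0; have ec0 : 0 < (e%:C : C) by rewrite ltcR.
have /near0P[a a0 ha] : nbhs (0 : R[i]^o) (fun h => h != 0 ->
    `|d - h^-1 * (Cauchy mu (h * 1 + z) - Cauchy mu z)| <= e%:C).
  exact: (proj1 (cvgrPdist_le _ _) lim_d _ ec0).
pose k := Num.min (a / 2) e.
have k0 : 0 < k by rewrite lt_min divr_gt0.
have kC0 : k%:C != 0 :> C by rewrite -nc_gt0 nc_real normr_gt0 gt_eqF.
have ka : nc k%:C < a.
  rewrite nc_real ger0_norm ?(ltW k0)//; have : k <= a / 2 by rewrite ge_min lexx.
  by lra.
have := ha _ ka kC0; rewrite normr_nc lecR mulr1 [k%:C + z]addrC => h1.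
have := Cauchy_second_order mT (muT mu) (sep k) sepz.
have zk : z + k%:C - z = k%:C by rewrite addrC addKr.
rewrite zk nc_real ger0_norm ?(ltW k0)// -/D.
rewrite -exprS.
move=> h2.
have -> : d - D = (d - k%:C^-1 * (Cauchy mu (z + k%:C) - Cauchy mu z)) +
    k%:C^-1 * (Cauchy mu (z + k%:C) - Cauchy mu z - k%:C * D).
  by move: (k%:C) kC0 => kc kc0; field.
apply: (le_trans (ncD _ _)); rewrite mulrDl mul1r lerD//.
rewrite ncM ncV nc_real ger0_norm ?(ltW k0)// ler_pdivrMl//.
apply: (le_trans h2); have -> : 2 * (k ^+ 2 / y ^+ 3) = k * (2 / y ^+ 3 * k).
  by rewrite expr2; field; rewrite gt_eqF// z0.
by rewrite ler_wpM2l ?(ltW k0)// ler_wpM2l ?(ltW y3)// ge_min lexx orbT.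
Qed.

(* The difference quotients of [Cauchy (mu r)] at [w] converge uniformly in
   [r], so continuity in time passes from [Cauchy (mu r)] to its derivative. *)
Lemma Cauchy_deriv_continuous (mu : R -> borelprob R) (s : R) (w : C) :
  0 < complex.Im w ->
  (forall z, 0 < complex.Im z -> exists d, tderive (fun r => Cauchy (mu r) z) s d) ->
  forall e, 0 < e -> exists2 a : R, 0 < a & forall r, 0 <= r -> `|r - s| < a ->
    nc (Cauchy_deriv (mu r) setT w - Cauchy_deriv (mu s) setT w) <= e.
Proof.
move=> w0 hd e e0; pose y := complex.Im w.
have y30 : 0 < y ^+ 3 by rewrite exprn_gt0.
(* With this increment the second-order error 2 k^2/y^3 equals k e/4; two such errors and two from
   continuity in time add up to k e. *)
pose k := e * y ^+ 3 / 8; have k0 : 0 < k by rewrite divr_gt0// mulr_gt0.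
have wk : 0 < complex.Im (w + k%:C) by rewrite ImD/= addr0.
have sep : separated setT (w + k%:C) y.
  by apply: separated_Im => //; rewrite ImD/= addr0.
have sepw : separated setT w y by apply: separated_Im.
have [d1 h1] := hd _ w0; have [d2 h2] := hd _ wk.
have ke : 0 < k * e / 4 by rewrite divr_gt0// mulr_gt0.
have [a1 a10 c1] := tderive_continuous h1 ke.
have [a2 a20 c2] := tderive_continuous h2 ke.
exists (Num.min a1 a2) => [|r r0]; first by rewrite lt_min a10.
rewrite lt_min => /andP[ra1 ra2].
have bound q : nc (Cauchy (mu q) (w + k%:C) - Cauchy (mu q) w -
    k%:C * Cauchy_deriv (mu q) setT w) <= k * e / 4.
  have := Cauchy_second_order mT (muT (mu q)) sep sepw.
  have zk : w + k%:C - w = k%:C by rewrite addrC addKr.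
  rewrite zk nc_real ger0_norm ?(ltW k0)// -exprS.
  suff -> : 2 * (k ^+ 2 / y ^+ 3) = k * e / 4 by [].
  by rewrite /k; field; rewrite gt_eqF.
rewrite -(ler_pM2l k0).
have -> : k * nc (Cauchy_deriv (mu r) setT w - Cauchy_deriv (mu s) setT w) =
  nc (k%:C * (Cauchy_deriv (mu r) setT w - Cauchy_deriv (mu s) setT w)).
  by rewrite ncM nc_real ger0_norm// ltW.
have B1 := bound r; have B2 := bound s.
have B3 := c1 r r0 ra1; have B4 := c2 r r0 ra2.
move: B1 B2 B3 B4; set Dr := Cauchy_deriv (mu r) _ _; set Ds := Cauchy_deriv (mu s) _ _.
set gr := Cauchy (mu r) w; set gs := Cauchy (mu s) w.
set gr' := Cauchy (mu r) _; set gs' := Cauchy (mu s) _ => B1 B2 B3 B4.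
have -> : k%:C * (Dr - Ds) = ((gs' - gs - k%:C * Ds) - (gr' - gr - k%:C * Dr)) +
   ((gr' - gs') - (gr - gs)) by ring.
apply: (le_trans (ncD _ _)); apply: (le_trans (lerD (ncB _ _) (ncB _ _))).
lra.
Qed.

(** The error splits into four parts: the second-order remainder in z at time r, the change of the
    z-derivative between times s and r, the error of Z, and that of the time derivative at fixed
    z. *)
Lemma tderive_Cauchy (mu : R -> borelprob R) (Z : R -> C) (s : R) (Gt dZ : C) :
  0 <= s -> 0 < complex.Im (Z s) ->
  (forall z, 0 < complex.Im z -> exists d, tderive (fun r => Cauchy (mu r) z) s d) ->
  tderive (fun r => Cauchy (mu r) (Z s)) s Gt -> tderive Z s dZ ->
  tderive (fun r => Cauchy (mu r) (Z r)) s
    (Gt + dZ * Cauchy_deriv (mu s) setT (Z s)).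
Proof.
move=> s0 w0 hd hGt hZ e e0; set w := Z s; set D := Cauchy_deriv (mu s) setT w.
pose y := complex.Im w / 2; have y0 : 0 < y by rewrite divr_gt0.
have sepw : separated setT w y by apply: separated_Im => //; rewrite /y; lra.
have [a1 [K [a10 K0 h1]]] := tderive_lip hZ.
have e4 : 0 < e / 4 by rewrite divr_gt0.
have [a2 a20 h2] := hGt _ e4.
have D1 : 0 < nc D + 1 by rewrite ltr_wpDl ?nc_ge0.
have e4D : 0 < e / 4 / (nc D + 1) by rewrite divr_gt0.
have [a3 a30 h3] := hZ _ e4D.
have e4K : 0 < e / 4 / K by rewrite divr_gt0.
have [a4 a40 h4] := Cauchy_deriv_continuous w0 hd e4K.
have [a5 a50 h5] := tderive_continuous hZ y0.
pose a6 := e / 4 / (2 * K ^+ 2 / y ^+ 3).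
have a60 : 0 < a6 by rewrite !divr_gt0// ?mulr_gt0 ?exprn_gt0.
exists (Num.min (Num.min a1 a2) (Num.min (Num.min a3 a4) (Num.min a5 a6))) => [|r r0].
  by rewrite !lt_min a10 a20 a30 a40 a50 a60.
rewrite !lt_min => /andP[/andP[r1 r2] /andP[/andP[r3 r4] /andP[r5 r6]]].
have sepz : separated setT (Z r) y.
  apply: separated_Im => //.
  have := le_trans (ler_Im_nc _) (h5 r r0 r5).
  by rewrite ImD ImN ler_norml -/w /y => /andP[+ _]; lra.
have B1 := Cauchy_second_order mT (muT (mu r)) sepz sepw.
have B1' : 2 * (nc (Z r - w) ^+ 2 / (y * y ^+ 2)) <= e / 4 * `|r - s|.
  have zk : nc (Z r - w) ^+ 2 <= (K * `|r - s|) ^+ 2.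
    rewrite lerXn2r ?nnegrE ?nc_ge0 ?mulr_ge0 ?(ltW K0)//; exact: h1.
  apply: (@le_trans _ _ (2 * ((K * `|r - s|) ^+ 2 / (y * y ^+ 2)))).
    by rewrite ler_wpM2l// ler_wpM2r// invr_ge0 mulr_ge0 ?exprn_ge0 ?ltW.
  have -> : 2 * ((K * `|r - s|) ^+ 2 / (y * y ^+ 2)) =
    (`|r - s| * (2 * K ^+ 2 / y ^+ 3)) * `|r - s|.
    by field; rewrite gt_eqF.
  rewrite ler_wpM2r// -ler_pdivlMr; first exact: ltW.
  by rewrite divr_gt0 ?mulr_gt0 ?exprn_gt0.
have B2 : nc ((Z r - w) * (Cauchy_deriv (mu r) setT w - D)) <= e / 4 * `|r - s|.
  rewrite ncM (le_trans (ler_pM (nc_ge0 _) (nc_ge0 _) (h1 r r0 r1) (h4 r r0 r4)))//.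
  by rewrite le_eqVlt; apply/orP; left; apply/eqP; field; rewrite gt_eqF.
have B3 : nc ((Z r - w - (r - s)%:C * dZ) * D) <= e / 4 * `|r - s|.
  rewrite ncM (le_trans (ler_wpM2r (nc_ge0 _) (h3 r r0 r3)))//.
  have -> : e / 4 / (nc D + 1) * `|r - s| * nc D =
    e / 4 * `|r - s| * (nc D / (nc D + 1)) by field; rewrite gt_eqF.
  apply: ler_piMr; first by rewrite mulr_ge0// ltW.
  by rewrite ler_pdivrMr// mul1r lerDl.
have B4 := h2 r r0 r2; rewrite -/w in B4.
have {}B1 := le_trans B1 B1'.
have -> : Cauchy (mu r) (Z r) - Cauchy (mu s) w - (r - s)%:C * (Gt + dZ * D) =
  ((Cauchy (mu r) (Z r) - Cauchy (mu r) w - (Z r - w) * Cauchy_deriv (mu r) setT w)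
   + (Z r - w) * (Cauchy_deriv (mu r) setT w - D))
  + ((Z r - w - (r - s)%:C * dZ) * D
   + (Cauchy (mu r) w - Cauchy (mu s) w - (r - s)%:C * Gt)) by ring.
apply: (le_trans (ncD _ _)); apply: (le_trans (lerD (ncD _ _) (ncD _ _))).
lra.
Qed.

(** For the equation G_t + A(z, G) G_z = B(z, G), the difference f between G along Z and g has
    derivative B(Z, G) - B(Z, g) - (A(Z, G) - A(Z, g)) G_z. At height eta one has |G| <= 2/eta and
    |G_z| <= 2/eta^2, so |f'| is bounded by a multiple of |f| and Gronwall's lemma applies. *)
Lemma characteristic (E : C -> C -> C -> C -> Prop) (A B : C -> C -> C)
    (mu : R -> borelprob R) (Z g : R -> C) (T eta K : R) :
  solves_pde E mu ->
  (forall z G Gt Gz, E z G Gt Gz -> Gt = B z G - A z G * Gz) ->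
  0 < eta -> (forall s, 0 <= s <= T -> eta <= complex.Im (Z s)) ->
  (forall s, 0 <= s <= T -> tderive Z s (A (Z s) (g s)) /\ tderive g s (B (Z s) (g s))) ->
  (forall s G, 0 <= s <= T -> nc G <= 2 / eta ->
    nc (A (Z s) G - A (Z s) (g s)) <= K * nc (G - g s) /\
    nc (B (Z s) G - B (Z s) (g s)) <= K * nc (G - g s)) ->
  g 0 = Cauchy (mu 0) (Z 0) ->
  forall s, 0 <= s <= T -> Cauchy (mu s) (Z s) = g s.
Proof.
move=> pde EAB eta0 Zeta ode lip init.
suff h s : 0 <= s <= T -> Cauchy (mu s) (Z s) - g s = 0.
  by move=> s hs; apply/eqP; rewrite -subr_eq0 h.
move: s; apply: (@gronwall _ _ _ (K * (1 + 2 / eta ^+ 2))); last first.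
  by rewrite init subrr.
move=> s hs; have [s0 sT] := andP hs.
have Im0 : 0 < complex.Im (Z s) by rewrite (lt_le_trans eta0)// Zeta.
have sep : separated setT (Z s) eta by apply: separated_Im => //; exact: Zeta.
have [Gt [Gz [hGt hGz hE]]] := pde s (Z s) s0 Im0.
have hd z : 0 < complex.Im z -> exists d, tderive (fun r => Cauchy (mu r) z) s d.
  by move=> /(pde s z s0)[d [_ [/is_time_derive_tderive h _ _]]]; exists d.
have [dZ dg] := ode s hs.
have dG := tderive_Cauchy s0 Im0 hd (is_time_derive_tderive hGt) dZ.
rewrite -(is_cderive_Cauchy Im0 hGz) in dG.
exists (Gt + A (Z s) (g s) * Gz - B (Z s) (g s)).
  by apply: tderiveD => //; exact: tderiveN.
rewrite (EAB _ _ _ _ hE); set G := Cauchy _ _.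
have [lA lB] := lip s G hs (nc_Cauchy mT (muT _) sep).
have nGz : nc Gz <= 2 / eta ^+ 2.
  by rewrite (is_cderive_Cauchy Im0 hGz); exact: nc_Cauchy_deriv.
have -> : B (Z s) G - A (Z s) G * Gz + A (Z s) (g s) * Gz - B (Z s) (g s) =
  (B (Z s) G - B (Z s) (g s)) - (A (Z s) G - A (Z s) (g s)) * Gz by ring.
apply: (le_trans (ncB _ _)); rewrite ncM.
have := ler_pM (nc_ge0 _) (nc_ge0 _) lA nGz.
have -> : K * (1 + 2 / eta ^+ 2) * nc (G - g s) =
  K * nc (G - g s) + K * nc (G - g s) * (2 / eta ^+ 2) by ring.
lra.
Qed.

End Characteristics.

(** * From characteristics near infinity to germs at 0 *)

Section Germs.
Variable R : realType.
Local Notation C := R[i].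

(** Since |1/z - 1/w| = |z - w|/(|z||w|), any Lipschitz constant in z can be reached by going far
    enough. *)
Lemma lip_infty_contract (T : R) (phi : R -> C -> C) (e : R) : 0 < e ->
  lip_infty T phi -> exists2 rho : R, 0 < rho & forall s z w, 0 <= s <= T ->
    rho <= nc z -> rho <= nc w -> nc (phi s z - phi s w) <= e * nc (z - w).
Proof.
move=> e0 [r [K [r0 K0 h]]].
exists (Num.max (Num.max r 1) (K / e)) => [|s z w hs]; first by rewrite !lt_max r0.
rewrite !ge_max => /andP[/andP[z1 z2] z3] /andP[/andP[w1 w2] w3].
have z0 : 0 < nc z by rewrite (lt_le_trans r0).
have w0 : 0 < nc w by rewrite (lt_le_trans r0).
have [_ h1] := h _ _ _ hs z1 w1; apply: (le_trans h1).
have -> : z^-1 - w^-1 = - ((z - w) * (z^-1 * w^-1)).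
  by field; rewrite -!nc_gt0 z0 w0.
rewrite ncN ncM mulrCA [leRHS]mulrC ler_wpM2l ?nc_ge0// ncM !ncV -invfM.
rewrite ler_pdivrMr ?mulr_gt0// -ler_pdivrMl// mulrC.
by rewrite (le_trans z3)// ler_peMr// ltW.
Qed.

(** Every small nonzero u is g_T(z) for some large z, so an identity between germs at 0 may be
    checked in the parameter z; u = 0 is a separate case. *)
Lemma near0_of_infty (T : R) (g : R -> C -> C) (P : C -> Prop) : 0 <= T ->
  lip_infty T (fun s z => z * g s z) -> tends1_infty T (fun s z => z * g s z) ->
  P 0 -> near_infty T (fun _ z => P (g T z)) ->
  \forall z \near (0 : R[i]^o), P z.
Proof.
move=> T0 lip tends P0 [rho rho0 h].
have hT : 0 <= T <= T by rewrite T0 lexx.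
have [d d0 surj] := surjective_near0 lip tends rho hT.
apply/near0P; exists d => // u ud; have [->//|u0] := eqVneq u 0.
have [|z rz <-] := surj u; first by rewrite nc_gt0 u0.
exact: (h T z hT).
Qed.

Lemma Cauchy_lip (mu : borelprob R) (T : R) : P0 mu ->
  lip_infty T (fun _ z => Cauchy mu z).
Proof.
move=> /(Cauchy_lip_infty T)[h _].
apply: lip_infty_ext (lip_inftyM h (lip_infty_inv T)).
by apply: near_infty_imp (near_infty_neq0 T) => _ z _ z0; rewrite mulrAC divff// mul1r.
Qed.

Lemma Rtransform_along_characteristics
    (E : C -> C -> C -> C -> Prop) (A B : C -> C -> C)
    (mu : R -> borelprob R) (T : R) (Z g : R -> C -> C) :
  0 <= T -> P0 (mu T) -> solves_pde E mu ->
  (forall z G Gt Gz, E z G Gt Gz -> Gt = B z G - A z G * Gz) ->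
  (forall eta M : R, 0 < eta -> exists K : R, forall z G G',
    eta <= complex.Im z -> nc z <= M -> nc G <= M -> nc G' <= M ->
    nc (A z G - A z G') <= K * nc (G - G') /\
    nc (B z G - B z G') <= K * nc (G - G')) ->
  near_infty T (fun _ z => Z 0 z = z /\ g 0 z = Cauchy (mu 0) z) ->
  near_infty T (fun s z => tderive (Z ^~ z) s (A (Z s z) (g s z)) /\
                           tderive (g ^~ z) s (B (Z s z) (g s z))) ->
  near_infty T (fun s z => Z s z^* = (Z s z)^* /\ g s z^* = (g s z)^*) ->
  lip_infty T (fun s z => Z s z - z) ->
  lip_infty T (fun s z => g s z) ->
  near_infty T (fun _ z => g T z != 0 /\
    Rtransform (mu T) (g T z) = Z T z * g T z - 1).
Proof.
move=> T0 muT pde EAB AB init ode conj lipZ lipg.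
have hT : 0 <= T <= T by rewrite T0 lexx.
have [KZ KZ0 bZ] := lip_infty_bounded lipZ.
have [Kg Kg0 bg] := lip_infty_bounded lipg.
have half0 : 0 < (2^-1 : R) by rewrite invr_gt0.
have [r1 r10 cZ] := lip_infty_contract half0 lipZ.
have [r2 r20 cg] := lip_infty_contract ltr01 lipg.
have [r3 r30 cG] := lip_infty_contract ltr01 (Cauchy_lip T muT).
have far (P : C -> Prop) : near_infty T (fun _ z => P z) -> near_infty T (fun s z => P (Z s z)).
  move=> [r r0 h]; have := near_inftyI bZ (near_infty_ge T (r + KZ)).
  apply: near_infty_imp => s z hs [h1 h2]; apply: (h s) => //.
  have := ler_ncDl z (Z s z - z); have -> : z + (Z s z - z) = Z s z by ring.
  by lra.
have [r4 r40 big] := far _ (near_infty_ge T r3).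
have [r5 r50 cconj] := far _ (Cauchy_conj T muT).
suff [rho rho0 key] : exists2 rho : R, 0 < rho & forall z, rho <= nc z ->
    Cauchy (mu T) (Z T z) = g T z.
  have [r r0 hr] := far _ (Rtransform_Cauchy T muT).
  exists (Num.max r rho) => [|_ z _]; first by rewrite lt_max r0.
  by rewrite ge_max => /andP[z1 z2]; rewrite -key//; exact: (hr T z hT).
have [r6 r60 all6] := near_inftyI (near_inftyI init ode)
  (near_inftyI conj (near_inftyI bZ bg)).
have [rho rho0 ge_rho] : exists2 rho : R, 0 < rho & forall x : R, rho <= x ->
    [/\ r1 <= x, r2 <= x, r4 <= x, r5 <= x & r6 <= x].
  exists (Num.max (Num.max r1 r2) (Num.max r4 (Num.max r5 r6))) => [|x].
    by rewrite !lt_max r10.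
  by rewrite !ge_max => /andP[/andP[-> ->] /and3P[-> -> ->]].
have upper z : rho <= nc z -> 0 < complex.Im z -> Cauchy (mu T) (Z T z) = g T z.
  move=> /ge_rho[z1 z2 z4 z5 z6] y0; set y := complex.Im z in y0.
  have y20 : 0 < y / 2 by rewrite divr_gt0.
  (* Comparing z with its conjugate, the constant 1/2 for Z - id yields |Im Z - Im z| <= (Im
     z)/2. *)
  have ImZ s : 0 <= s <= T -> y / 2 <= complex.Im (Z s z).
    move=> hs; have [_ [[cj _] _]] := all6 s z hs z6.
    have := cZ s z z^* hs z1; rewrite nc_conj => /(_ z1); rewrite cj.
    have -> : Z s z - z - ((Z s z)^* - z^*) = (Z s z - z) - (Z s z - z)^*.
      by rewrite rmorphB.
    rewrite !nc_sub_conj ImD ImN -/y (gtr0_norm y0) => h.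
    have : `|complex.Im (Z s z) - y| <= y / 2 by lra.
    by rewrite ler_norml => /andP[+ _]; lra.
  pose M := Num.max (nc z + KZ) (Num.max Kg (2 / (y / 2))).
  have [K hK] := AB (y / 2) M y20.
  have h := @characteristic _ E A B mu (Z ^~ z) (g ^~ z) T (y / 2) K pde EAB y20 ImZ.
  apply: (h _ _ _ T hT) => [s hs|s G hs hG|].
  - by have [[_ [? ?]] _] := all6 s z hs z6.
  - have [_ [_ [h1 h2]]] := all6 s z hs z6; apply: hK; first exact: ImZ.
    + rewrite le_max; apply/orP; left.
      have -> : Z s z = z + (Z s z - z) by ring.
      by rewrite (le_trans (ncD _ _))// lerD2l.
    + by rewrite !le_max hG !orbT.
    + by rewrite !le_max h2 orbT.
  - by have [[[-> ->] _] _] := all6 T z hT z6.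
exists rho => // z hz; have [z1 z2 z4 z5 z6] := ge_rho _ hz.
have [y0|y0|y0] := ltrgtP (complex.Im z) 0.
- have hz' : rho <= nc z^* by rewrite nc_conj.
  have y0' : 0 < complex.Im z^* by move: y0; case: (z) => a b /=; rewrite oppr_gt0.
  have [_ [[cjZ cjg] _]] := all6 T z hT z6.
  have := upper _ hz' y0'; rewrite cjZ cjg (cconj T z hT z5) => h.
  by rewrite -[LHS]conjcK h conjcK.
- exact: upper.
(* A real z is approached by z + i e. The errors are at most 3e/2 for the Cauchy transform at Z and
   e for g. *)
- apply: (@complex_eq_eps _ _ _ 3) => // e e0; pose ze := z + 'i * e%:C.
  have Imze : complex.Im ze = e by rewrite ImD ImM y0 /=; ring.
  have nze : nc (z - ze) = e.
    rewrite /ze opprD addrA subrr add0r ncN ncM nc_real gtr0_norm//=.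
    by rewrite expr0n expr1n add0r sqrtr1 mul1r.
  have ze_ge : rho <= nc ze.
    apply: (le_trans hz); have Reze : complex.Re ze = complex.Re z.
      by rewrite ReD ReM/=; ring.
    have zE : z = (complex.Re z)%:C by rewrite -[LHS]complex_eta y0.
    by rewrite {1}zE nc_real -Reze ler_Re_nc.
  have [ze1 ze2 ze4 ze5 ze6] := ge_rho _ ze_ge.
  have -> : Cauchy (mu T) (Z T z) - g T z =
    (Cauchy (mu T) (Z T z) - Cauchy (mu T) (Z T ze)) - (g T z - g T ze).
    by rewrite (upper ze ze_ge) ?Imze//; ring.
  have B1 := cG T _ _ hT (big T z hT z4) (big T ze hT ze4).
  have B2 := cZ T _ _ hT z1 ze1; have B3 := cg T _ _ hT z2 ze2.
  have B4 : nc (Z T z - Z T ze) <= nc (Z T z - z - (Z T ze - ze)) + nc (z - ze).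
    by apply: le_trans (ncD _ _); rewrite le_eqVlt; apply/orP; left; apply/eqP; congr nc; ring.
  by apply: (le_trans (ncB _ _)); rewrite nze in B2 B3 B4; lra.
Qed.

End Germs.

Lemma Rtransform0 {R : realType} (mu : borelprob R) : Rtransform mu 0 = 0.
Proof. by rewrite /Rtransform eqxx. Qed.

(** * The semicircular flow: complex Burgers equation *)

Section SemicircularFlow.
Variable R : realType.
Local Notation C := R[i].

Lemma Rtransform_pde_w (w : R -> borelprob R) (t : R) : 0 <= t ->
  P0 (w 0) -> P0 (w t) -> solves_pde (@pde_w R) w ->
  \forall z \near (0 : R[i]^o),
    Rtransform (w t) z = Rtransform (w 0) z + t%:C * z ^+ 2.
Proof.
move=> t0 h0 ht pde; pose G := Cauchy (w 0).
have [lE tE] := Cauchy_lip_infty t h0.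
have lG := Cauchy_lip t h0.
pose Z (s : R) z := z + s%:C * G z.
have key : near_infty t (fun _ z => G z != 0 /\
    Rtransform (w t) (G z) = Z t z * G z - 1).
  apply: (@Rtransform_along_characteristics _ (@pde_w R) (fun _ g => g) (fun _ _ => 0)
    w t Z (fun _ => G) t0 ht pde).
  - by move=> z g Gt Gz /eqP; rewrite addr_eq0 sub0r => /eqP.
  - move=> eta M eta0; exists 1 => z g g' _ _ _ _.
    by rewrite mul1r subrr nc0 nc_ge0.
  - by exists 1 => // s z _ _; rewrite /Z mul0r addr0.
  - exists 1 => // s z _ _; split; last exact: tderive_cst.
    apply: tderive_eq (tderiveD (tderive_cst z s) (tderiveM (tderive_id s) (tderive_cst (G z) s))) _.
    by ring.
  - apply: near_infty_imp (Cauchy_conj t h0) => s z _ cj.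
    by rewrite /Z [G _]cj rmorphD rmorphM/= oppr0.
  - apply: lip_infty_ext (lip_inftyM (lip_infty_time t) lG).
    by exists 1 => // s z _ _; rewrite /Z addrC addKr.
  - exact: lG.
apply: (near0_of_infty (g := fun _ => G) t0 lE tE); first by rewrite !Rtransform0 expr0n mulr0 addr0.
apply: near_infty_imp (near_inftyI key (Rtransform_Cauchy t h0)) => s z _ [[G0 ->] [_ ->]].
by rewrite /Z /G; ring.
Qed.

End SemicircularFlow.

(** * The free Poisson flow *)

Section FreePoissonFlow.
Variable R : realType.
Local Notation C := R[i].

Lemma Rtransform_pde_m (lambda : R) (m : R -> borelprob R) (t : R) : 0 <= t ->
  P0 (m 0) -> P0 (m t) -> solves_pde (pde_m lambda) m ->
  \forall z \near (0 : R[i]^o),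
    Rtransform (m t) z =
      1 / (1 - t%:C * z) * Rtransform (m 0) (z / (1 - t%:C * z))
      + lambda%:C * t%:C * z / (1 - t%:C * z).
Proof.
move=> t0 h0 ht pde; pose G := Cauchy (m 0); pose a : C := 1 - lambda%:C.
have [lE tE] := Cauchy_lip_infty t h0.
have lG := Cauchy_lip t h0; have lt := lip_infty_time t.
have nz := near_infty_neq0 (R := R) t.
pose q (s : R) z := 1 + s%:C * G z.
have qE : near_infty t (fun s z => 1 + s%:C * (z * G z) * z^-1 = q s z).
  by apply: near_infty_imp nz => s z _ z0; rewrite /q; field.
have lq : lip_infty t q.
  exact: lip_infty_ext qE (lip_infty_lin (lip_inftyM lt lE)).
have tq : tends1_infty t q.
  exact: tends1_infty_ext qE (tends1_infty_lin (lip_inftyM lt lE)).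
have nq := tends1_neq0 tq.
pose Z (s : R) z := q s z ^+ 2 * z - a * s%:C * q s z.
pose g (s : R) z := G z / q s z.
have lg : lip_infty t g by apply: lip_inftyM => //; exact: lip_inftyV.
have key : near_infty t (fun _ z => g t z != 0 /\
    Rtransform (m t) (g t z) = Z t z * g t z - 1).
  apply: (@Rtransform_along_characteristics _ (pde_m lambda)
    (fun z g => 2 * z * g - a) (fun _ g => - g ^+ 2) m t Z g t0 ht pde).
  - move=> z g' Gt Gz /eqP; rewrite -addrA addr_eq0 => /eqP ->.
    by rewrite /a; ring.
  - move=> eta M eta0; exists (2 * `|M|) => z g1 g2 _ zM g1M g2M.
    have leM (x : R) : x <= M -> x <= `|M| by move=> h; rewrite (le_trans h)// ler_norm.
    split.
      have -> : 2 * z * g1 - a - (2 * z * g2 - a) = 2 * z * (g1 - g2) by ring.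
      by rewrite !ncM nc_nat ler_wpM2r ?nc_ge0// ler_wpM2l// leM.
    have -> : - g1 ^+ 2 - - g2 ^+ 2 = - ((g1 + g2) * (g1 - g2)) by ring.
    rewrite ncN ncM ler_wpM2r ?nc_ge0// (le_trans (ncD _ _))//.
    by rewrite mulr_natl mulr2n lerD// leM.
  - by exists 1 => // s z _ _; rewrite /Z /g /q !mul0r !addr0 mulr0 mul0r subr0 expr1n mul1r divr1.
  - apply: near_infty_imp nq => s z _ q0.
    have dq : tderive (q ^~ z) s (G z).
      apply: tderive_eq (tderiveD (tderive_cst 1 s) (tderiveM (tderive_id s) (tderive_cst (G z) s))) _.
      by ring.
    split.
      have d1 := tderiveM (tderiveM dq dq) (tderive_cst z s).
      have d2 := tderiveN (tderiveM (tderiveM (tderive_cst a s) (tderive_id s)) dq).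
      apply: tderive_eq (tderiveD d1 d2) _.
      by rewrite /Z /g; move: q0; rewrite /q => q0; field.
    apply: tderive_eq (tderiveM (tderive_cst (G z) s) (tderiveV q0 dq)) _.
    by rewrite /g; field.
  - apply: near_infty_imp (Cauchy_conj t h0) => s z _ cj.
    rewrite /Z /g /q /a [G _]cj !(rmorphB, rmorphM, rmorphXn, rmorphD, fmorphV, rmorph1)/=.
    by rewrite !oppr0.
  (* The factor z in (q^2 - 1) z is absorbed by the bounded function z G(z). *)
  - have lz : lip_infty t (fun s z => 2 * s%:C * (z * G z) + s%:C ^+ 2 * G z * (z * G z) - a * s%:C * q s z).
      apply: lip_inftyD; first apply: lip_inftyD.
      + by do 2 apply: lip_inftyM => //; exact: lip_infty_cst.
      + by do 3 apply: lip_inftyM => //.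
      + by apply: lip_inftyN; do 2 apply: lip_inftyM => //; exact: lip_infty_cst.
    apply: lip_infty_ext lz; exists 1 => // s z _ _.
    by rewrite /Z /q; ring.
  - exact: lg.
have gE : near_infty t (fun s z => z * G z * (q s z)^-1 = z * g s z).
  by exists 1 => // s z _ _; rewrite mulrA.
apply: (near0_of_infty (g := g) t0).
- by apply: lip_infty_ext gE _; apply: lip_inftyM => //; exact: lip_inftyV.
- by apply: tends1_infty_ext gE _; apply: tends1_inftyM => //; exact: tends1_inftyV.
- by rewrite !mulr0 !mul0r !Rtransform0 mulr0 addr0.
have nqt : near_infty t (fun _ z => q t z != 0).
  by have [r r0 h] := nq; exists r => // s z _ rz; apply: h => //; rewrite t0 lexx.
apply: near_infty_imp (near_inftyI nqt (near_inftyI key (Rtransform_Cauchy t h0))).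
move=> s z _ [q0 [[g0 ->] [_ RG]]].
(* Hence u/(1 - t u) = G(z) at u = g_t(z): the initial R-transform is evaluated exactly where it is
   known. *)
have e1 : 1 - t%:C * g t z = (q t z)^-1.
  by rewrite /g; move: q0; rewrite /q => q0; field.
have e2 : g t z / (q t z)^-1 = G z by rewrite /g invrK divfK.
rewrite e1 e2 RG /Z /g /a -/G.
by move: q0; rewrite /q => q0; field.
Qed.

End FreePoissonFlow.

(** * The symmetric flow, with its square roots *)

Section SymmetricFlow.
Variable R : realType.
Local Notation C := R[i].

Lemma Re_near1 (x : C) : nc (x - 1) <= 2^-1 -> 0 < complex.Re x.
Proof.
move=> h; have := le_trans (ler_Re_nc _) h; rewrite ReD ReN ler_norml/= => /andP[+ _].
by lra.
Qed.

(** Used with phi the root of p: half of 1 + phi is, up to the factor 2, the denominator in sqrt p -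
    1 = (p - 1)/(sqrt p + 1), through which Z - z is bounded. *)
Lemma tends1_infty_mid (T : R) (phi : R -> C -> C) : tends1_infty T phi ->
  tends1_infty T (fun s z => 2^-1 * (1 + phi s z)).
Proof.
move=> h e e0; apply: near_infty_imp (h e e0) => s z _ hs.
have -> : 2^-1 * (1 + phi s z) - 1 = 2^-1 * (phi s z - 1) by field.
by rewrite ncM ncV nc_nat; have := nc_ge0 (phi s z - 1); lra.
Qed.

Variables (lambda : R) (wl : R -> borelprob R) (t : R).
Hypothesis t0 : 0 <= t.
Hypothesis h0 : P0 (wl 0).
Hypothesis ht : P0 (wl t).
Hypothesis pde : solves_pde (pde_wl lambda) wl.

Let G := Cauchy (wl 0).
Let a : C := 1 - lambda%:C.
Let q (s : R) z := 1 + s%:C * (G z / z).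
Let p (s : R) z := q s z ^+ 2 - a * s%:C * q s z / z ^+ 2.
Let Z (s : R) z := z * sqrtc (p s z).
Let g (s : R) z := Z s z * (G z / z) / q s z.

Let nz := near_infty_neq0 (R := R) t.
Let lt := lip_infty_time t.
Let li := lip_infty_inv t.
Let lc c := lip_infty_cst t (c : C).

Let lE : lip_infty t (fun _ z => z * G z).
Proof. by have [] := Cauchy_lip_infty t h0. Qed.

Let tE : tends1_infty t (fun _ z => z * G z).
Proof. by have [] := Cauchy_lip_infty t h0. Qed.

Let lG : lip_infty t (fun _ z => G z). Proof. exact: Cauchy_lip. Qed.

Let qE : near_infty t (fun s z => 1 + s%:C * G z * z^-1 = q s z).
Proof. by exists 1 => // s z _ _; rewrite /q mulrA. Qed.

Let lq : lip_infty t q.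
Proof. exact: lip_infty_ext qE (lip_infty_lin (lip_inftyM lt lG)). Qed.

Let tq : tends1_infty t q.
Proof. exact: tends1_infty_ext qE (tends1_infty_lin (lip_inftyM lt lG)). Qed.

Let psi (s : R) z := 2 * s%:C * G z + s%:C ^+ 2 * G z ^+ 2 * z^-1 - a * s%:C * q s z * z^-1.

Let lpsi : lip_infty t psi.
Proof.
apply: lip_inftyD; first apply: lip_inftyD.
- by do 2 apply: lip_inftyM => //.
- by do 3 apply: lip_inftyM => //.
- by apply: lip_inftyN; do 3 apply: lip_inftyM => //.
Qed.

Let pE : near_infty t (fun s z => 1 + psi s z * z^-1 = p s z).
Proof. by apply: near_infty_imp nz => s z _ z0; rewrite /psi /p /q; field. Qed.

Let lp : lip_infty t p.
Proof. exact: lip_infty_ext pE (lip_infty_lin lpsi). Qed.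

Let tp : tends1_infty t p.
Proof. exact: tends1_infty_ext pE (tends1_infty_lin lpsi). Qed.

Let lr : lip_infty t (fun s z => sqrtc (p s z)).
Proof. exact: lip_infty_sqrtc. Qed.

Let tr : tends1_infty t (fun s z => sqrtc (p s z)).
Proof. exact: tends1_infty_sqrtc. Qed.

Let lZ : lip_infty t (fun s z => Z s z - z).
Proof.
have tm := tends1_infty_mid tr.
have lm : lip_infty t (fun s z => 2^-1 * (1 + sqrtc (p s z))).
  by apply: lip_inftyM => //; exact: lip_inftyD.
apply: lip_infty_ext (lip_inftyM (lip_inftyM (lc 2^-1) lpsi) (lip_inftyV tm lm)).
have := near_inftyI (tends1_neq0 tm) (near_inftyI nz pE).
apply: near_infty_imp => s z _ [m0 [z0 pz]].
have sq := sqr_sqrtc (p s z); rewrite /Z.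
have {}pz : psi s z = (p s z - 1) * z by rewrite -pz; field.
rewrite pz -{1}sq; move: m0; rewrite mulf_eq0 negb_or => /andP[_ m0].
by field.
Qed.

Let gE : near_infty t (fun s z => sqrtc (p s z) * (z * G z) * (q s z)^-1 = z * g s z).
Proof. by apply: near_infty_imp (near_inftyI nz (tends1_neq0 tq)) => s z _ [z0 q0]; rewrite /g /Z; field; rewrite z0 q0. Qed.

Let lEg : lip_infty t (fun s z => z * g s z).
Proof.
apply: lip_infty_ext gE _; apply: lip_inftyM; last exact: lip_inftyV.
exact: lip_inftyM.
Qed.

Let tEg : tends1_infty t (fun s z => z * g s z).
Proof.
apply: tends1_infty_ext gE _; apply: tends1_inftyM; last exact: tends1_inftyV.
exact: tends1_inftyM.
Qed.

Let lg : lip_infty t g.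
Proof.
apply: lip_infty_ext (lip_inftyM lEg li).
by apply: near_infty_imp nz => s z _ z0; field.
Qed.

Let ode : near_infty t (fun s z =>
  tderive (Z ^~ z) s (g s z - a / (2 * Z s z)) /\
  tderive (g ^~ z) s (- (a / (2 * Z s z ^+ 2)) * g s z)).
Proof.
have q40 : 0 < (4^-1 : R) by rewrite invr_gt0.
have := near_inftyI nz (near_inftyI (tends1_neq0 tq) (near_inftyI (tp q40) (tends1_neq0 tr))).
apply: near_infty_imp => s z _ [z0 [q0 [p1 r0]]].
have rp := sqr_sqrtc (p s z); set r := sqrtc (p s z) in r0 rp.
have dq : tderive (q ^~ z) s (G z / z).
  apply: tderive_eq (tderiveD (tderive_cst 1 s) (tderiveM (tderive_id s) (tderive_cst (G z / z) s))) _.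
  by ring.
have dp : tderive (p ^~ z) s (2 * q s z * (G z / z) - a * (1 + 2 * s%:C * (G z / z)) / z ^+ 2).
  have d1 := tderiveM dq dq.
  have d2 := tderiveM (tderiveM (tderive_cst a s) (tderive_id s)) dq.
  have d3 := tderiveN (tderiveM d2 (tderive_cst (z ^- 2) s)).
  by apply: tderive_eq (tderiveD d1 d3) _; rewrite /q; field.
have dZ : tderive (Z ^~ z) s (g s z - a / (2 * Z s z)).
  apply: tderive_eq (tderiveM (tderive_cst z s) (tderive_sqrtc p1 dp)) _.
  rewrite /g /Z -/r.
  have -> : z * r * (G z / z) / q s z = (r ^+ 2 * G z / q s z) / r by field; rewrite z0 q0 r0.
  rewrite rp /p; move: q0; rewrite /q; set k := G z / z => q0.
  have -> : G z = k * z by rewrite /k divfK.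
  by field; rewrite r0 z0 q0.
split => //.
have d := tderiveM (tderiveM dZ (tderive_cst (G z / z) s)) (tderiveV q0 dq).
apply: tderive_eq d _; rewrite /g /Z -/r.
by field; rewrite r0 z0 q0.
Qed.

Lemma Rtransform_wl_param : near_infty t (fun _ z => g t z != 0 /\
  Rtransform (wl t) (g t z) = Z t z * g t z - 1).
Proof.
apply: (@Rtransform_along_characteristics _ (pde_wl lambda)
    (fun z g => g - a / (2 * z)) (fun z g => - (a / (2 * z ^+ 2)) * g) wl t Z g t0 ht pde).
- move=> z g' Gt Gz /eqP; rewrite -addrA addr_eq0 => /eqP ->.
  by rewrite /a; ring.
- move=> eta M eta0; exists (1 + nc a / (2 * eta ^+ 2)) => z g1 g2 zeta _ _ _.
  have ze : eta <= nc z.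
    by rewrite (le_trans zeta)// (le_trans (ler_norm _))// ler_Im_nc.
  have c0 : 0 <= nc a / (2 * eta ^+ 2).
    by rewrite divr_ge0 ?nc_ge0// mulr_ge0// exprn_ge0// ltW.
  split.
    have -> : g1 - a / (2 * z) - (g2 - a / (2 * z)) = g1 - g2 by ring.
    by rewrite ler_peMl ?nc_ge0// lerDl.
  have -> : - (a / (2 * z ^+ 2)) * g1 - - (a / (2 * z ^+ 2)) * g2 =
    - (a / (2 * z ^+ 2) * (g1 - g2)) by ring.
  rewrite ncN ncM ler_wpM2r ?nc_ge0// ncM ncV ncM ncX nc_nat.
  apply: (@le_trans _ _ (nc a / (2 * eta ^+ 2))); last by rewrite lerDr.
  have z0 : 0 < nc z by exact: lt_le_trans ze.
  rewrite ler_wpM2l ?nc_ge0// lef_pV2 ?posrE ?mulr_gt0 ?exprn_gt0//.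
  by rewrite ler_wpM2l// lerXn2r ?nnegrE ?nc_ge0// ltW.
- apply: near_infty_imp nz => s z _ z0.
  have p0 : p 0 z = 1 by rewrite /p /q !mul0r !addr0 mulr0 !mul0r expr1n subr0.
  rewrite /g /Z p0 sqrtc1 mulr1 /q mul0r addr0 divr1 mulrC divfK//.
- exact: ode.
- have q20 : 0 < (2^-1 : R) by rewrite invr_gt0.
  have := near_inftyI (tends1_sqrtc tp) (Cauchy_conj t h0).
  apply: near_infty_imp => s z _ [rp cj].
  have qc : q s z^* = (q s z)^*.
    by rewrite /q [G _]cj !(rmorphM, rmorphD, fmorphV, rmorph1)/= oppr0.
  have pc : p s z^* = (p s z)^*.
    rewrite /p qc /a !(rmorphB, rmorphM, rmorphXn, fmorphV, rmorph1)/=.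
    by rewrite !oppr0.
  have rc : sqrtc (p s z^*) = (sqrtc (p s z))^*.
    by rewrite pc sqrtc_conj// (lt_le_trans q20).
  have Zc : Z s z^* = (Z s z)^* by rewrite /Z rc rmorphM.
  by rewrite /g Zc qc [G _]cj !(rmorphM, fmorphV).
- exact: lZ.
- exact: lg.
Qed.

(** The contribution of the fundamental solution appears here already evaluated, as [t u^2]. *)
Lemma Rtransform_pde_wl : \forall u \near (0 : R[i]^o),
  Rtransform (wl t) u + (1 - lambda%:C) * t%:C * u ^+ 2 / (Rtransform (wl t) u + 1) =
  t%:C * u ^+ 2 + Rtransform (wl 0)
    (u * sqrtc (1 - (1 - lambda%:C) * ((Rtransform (wl t) u + 1)^-1
                   - (Rtransform (wl t) u + 1 - t%:C * u ^+ 2)^-1))).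
Proof.
apply: (near0_of_infty (g := g) t0 lEg tEg).
  by rewrite expr0n !mulr0 !mul0r !Rtransform0.
have at_t (P : R -> C -> Prop) : near_infty t P -> near_infty t (fun _ z => P t z).
  by move=> [r r0 h]; exists r => // s z _ rz; apply: h => //; rewrite t0 lexx.
have q20 : 0 < (2^-1 : R) by rewrite invr_gt0.
have tqr := tends1_inftyM tq (tends1_inftyV tr).
have := near_inftyI (near_inftyI nz (near_inftyI (at_t _ (tends1_neq0 tq)) (at_t _ (tqr _ q20))))
  (near_inftyI (near_inftyI (at_t _ (tends1_neq0 tr)) (tends1_neq0 tE))
  (near_inftyI Rtransform_wl_param (Rtransform_Cauchy t h0))).
apply: near_infty_imp => s z _ [[z0 [q0 Re0]] [[r0 E0] [[g0 RX] [_ RG]]]].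
rewrite RX subrK -/a; have rp := sqr_sqrtc (p t z).
set r := sqrtc (p t z) in r0 rp Re0.
have G0 : G z != 0 by apply: contra E0 => /eqP ->; rewrite mulr0.
pose k := G z / z; have k0 : k != 0 by rewrite /k mulf_neq0// invr_neq0.
have Gk : G z = k * z by rewrite /k divfK.
have Zr : Z t z = z * r by [].
have gk : g t z = z * r * k / q t z by [].
have XE : Z t z * g t z = z ^+ 2 * r ^+ 2 * k / q t z by rewrite Zr gk; field.
have u2E : g t z ^+ 2 = z ^+ 2 * r ^+ 2 * k ^+ 2 / q t z ^+ 2 by rewrite gk; field.
have qk : q t z = 1 + t%:C * k by [].
(* Put X = Z g, the value of R + 1. Then X - t u^2 = X/q, so the radicand is 1 + a (q - 1)/X =
   (q/r)^2 by definition of p; q/r is near 1, hence the principal root, and u q/r = G(z). *)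
have arg : g t z * sqrtc (1 - a * ((Z t z * g t z)^-1 - (Z t z * g t z - t%:C * g t z ^+ 2)^-1)) = G z.
  have -> : sqrtc (1 - a * ((Z t z * g t z)^-1 - (Z t z * g t z - t%:C * g t z ^+ 2)^-1)) = q t z / r.
    apply: sqrtc_unique; last exact: Re_near1.
    rewrite XE u2E.
    have -> : z ^+ 2 * r ^+ 2 * k / q t z - t%:C * (z ^+ 2 * r ^+ 2 * k ^+ 2 / q t z ^+ 2) =
      z ^+ 2 * r ^+ 2 * k / q t z ^+ 2.
      by move: q0; rewrite qk => q0; field.
    have -> : (q t z / r) ^+ 2 = (p t z + a * t%:C * q t z / z ^+ 2) / r ^+ 2.
      by rewrite /p subrK; field.
    by rewrite -rp; move: q0; rewrite qk => q0; field; rewrite r0 z0 k0 q0.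
  by rewrite gk Gk; field; rewrite r0 q0.
rewrite arg RG -/G XE u2E Gk rp /p.
have pn : q t z ^+ 2 - a * t%:C * q t z / z ^+ 2 != 0.
  by rewrite -/(p t z) -rp expf_neq0.
have num : (q t z * z) ^+ 2 - a * t%:C * q t z != 0.
  apply: contra pn => /eqP h.
  have -> : q t z ^+ 2 - a * t%:C * q t z / z ^+ 2 =
    ((q t z * z) ^+ 2 - a * t%:C * q t z) / z ^+ 2 by field.
  by rewrite h mul0r.
move: q0 num; rewrite qk => q0 num; field.
by rewrite z0 k0 q0.
Qed.

Lemma Rtransform_pde_wl_fundamental : (forall z, G z = z^-1) ->
  \forall u \near (0 : R[i]^o),
  Rtransform (wl t) u = 1 / 2 * (- 1 + t%:C * u ^+ 2
    + sqrtc (1 + 2 * (2 * lambda%:C - 1) * t%:C * u ^+ 2 + t%:C ^+ 2 * u ^+ 4)).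
Proof.
move=> Ginv; apply: (near0_of_infty (g := g) t0 lEg tEg).
  have e2 : (0 : C) ^+ 2 = 0 by rewrite expr0n.
  have e4 : (0 : C) ^+ 4 = 0 by rewrite expr0n.
  by rewrite Rtransform0 e2 e4 !mulr0 !addr0 sqrtc1 addNr mulr0.
have at_t (P : R -> C -> Prop) : near_infty t P -> near_infty t (fun _ z => P t z).
  by move=> [r r0 h]; exists r => // s z _ rz; apply: h => //; rewrite t0 lexx.
have q20 : 0 < (2^-1 : R) by rewrite invr_gt0.
have tpq := tends1_inftyM tp (tends1_inftyV tq).
have tpqq := tends1_inftyM tpq (tends1_inftyV tq).
have q40 : 0 < (4^-1 : R) by rewrite invr_gt0.
have := near_inftyI (near_inftyI nz (near_inftyI (at_t _ (tends1_neq0 tq)) (at_t _ (tpq _ q40))))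
  (near_inftyI (at_t _ (tpqq _ q40)) Rtransform_wl_param).
apply: near_infty_imp => s z _ [[z0 [q0 c1]] [c2 [_ ->]]].
have rp := sqr_sqrtc (p t z).
(* With G = 1/z everything depends on h alone: q = 1 + h, p = (1 + h)(1 + lambda h), and the
   R-transform at u is lambda h. *)
pose h := t%:C / z ^+ 2.
have qh : q t z = 1 + h by rewrite /q Ginv /h; field.
have ph : p t z = (1 + h) * (1 + h - a * h) by rewrite /p qh /h; field.
have h1 : 1 + h != 0 by rewrite -qh.
have XE : Z t z * g t z = p t z / q t z.
  have -> : Z t z * g t z = sqrtc (p t z) ^+ 2 / q t z.
    by rewrite /g /Z Ginv; field; rewrite z0 q0.
  by rewrite rp.
have uE : t%:C * g t z ^+ 2 = p t z * h / q t z ^+ 2.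
  have -> : t%:C * g t z ^+ 2 = sqrtc (p t z) ^+ 2 * h / q t z ^+ 2.
    by rewrite /g /Z Ginv /h; field; rewrite z0 q0.
  by rewrite rp.
have u4E : t%:C ^+ 2 * g t z ^+ 4 = (t%:C * g t z ^+ 2) ^+ 2 by ring.
rewrite u4E -[2 * _ * t%:C * _]mulrA uE XE.
(* The right-hand side is 2 R + 1 - t u^2 in terms of p and q. It is within 1/4 + 1/4 of 1, which
   selects the principal root. *)
have -> : sqrtc (1 + 2 * (2 * lambda%:C - 1) * (p t z * h / q t z ^+ 2) + (p t z * h / q t z ^+ 2) ^+ 2)
    = p t z / q t z - 1 + p t z / q t z / q t z.
  apply: sqrtc_unique.
    by rewrite ph qh /a; field.
  apply: Re_near1.
  have -> : p t z / q t z - 1 + p t z / q t z / q t z - 1 =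
    (p t z / q t z - 1) + (p t z / q t z / q t z - 1) by ring.
  by apply: (le_trans (ncD _ _)); move: c1 c2; lra.
by rewrite ph qh; field.
Qed.

End SymmetricFlow.

(** * Polynomials converging to the indicator of a half-line *)

Section ThresholdPolynomials.
Variable R : realType.

Lemma bernoulli_ineq (y : R) k : -1 <= y -> 1 + k%:R * y <= (1 + y) ^+ k.
Proof.
move=> y1; elim: k => [|k ih]; first by rewrite mul0r addr0 expr0.
have y0 : 0 <= 1 + y by lra.
rewrite exprS; apply: le_trans (ler_wpM2l y0 ih).
rewrite -[k.+1]addn1 natrD.
have := mulr_ge0 (ler0n R k) (sqr_ge0 y); rewrite expr2; lra.
Qed.

(* With n = m^2 and k = 2^(m^2 - m), the product k w^n is at most 2^-m when
   w <= 1/2 and eventually at least 2^m when w > 1/2; by Bernoulli's inequality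
   [threshold m w] then tends to the indicator of w <= 1/2, end point included. *)
Definition threshold (m : nat) (w : R) : R :=
  (1 - w ^+ (m * m)) ^+ (2 ^ (m * m - m)).

Lemma threshold_itv m (w : R) : 0 <= w <= 1 -> 0 <= threshold m w <= 1.
Proof.
move=> /andP[w0 w1]; have y0 : 0 <= w ^+ (m * m) by rewrite exprn_ge0.
have y1 : w ^+ (m * m) <= 1 by rewrite exprn_ile1.
rewrite /threshold exprn_ge0 ?subr_ge0//= exprn_ile1// ?subr_ge0//.
by rewrite lerBlDr lerDl.
Qed.

Lemma threshold_le m (w : R) : 0 <= w <= 2^-1 -> `|1 - threshold m w| <= 1 / 2 ^+ m.
Proof.
move=> /andP[w0 w1]; have w01 : 0 <= w <= 1 by rewrite w0/=; lra.
have /andP[t0 t1] := threshold_itv m w01.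
rewrite ger0_norm ?subr_ge0//.
have y1 : w ^+ (m * m) <= 1 by rewrite exprn_ile1//; lra.
have := @bernoulli_ineq (- w ^+ (m * m)) (2 ^ (m * m - m)); rewrite lerN2 => /(_ y1).
rewrite -/(threshold m w) mulrN => h.
have : (2 ^ (m * m - m))%:R * w ^+ (m * m) <= 1 / 2 ^+ m; last by lra.
rewrite natrX ler_pdivlMr ?exprn_gt0// mulrAC -exprD subnK; last first.
  by case: (m) => // n; rewrite leq_pmulr.
by rewrite -exprMn exprn_ile1 ?mulr_ge0//; lra.
Qed.

Lemma threshold_gt (w : R) : 2^-1 < w <= 1 ->
  exists m0, forall m, (m0 <= m)%N -> `|0 - threshold m w| <= 1 / 2 ^+ m.
Proof.
move=> /andP[w0 w1]; have w01 : 0 <= w <= 1 by rewrite w1 andbT; lra.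
pose v := 2 * w; pose d := v - 1; have d0 : 0 < d by rewrite /d /v; lra.
(* For m >= n, Bernoulli gives (2w)^m >= 1 + m d >= 4; hence (2w)^(m m) >= 4^m and k w^(m m) >=
   4^m/2^m = 2^m, where k is the outer exponent. *)
have [n hn] : exists n : nat, 3 / d < n%:R.
  by exists (Num.bound (3 / d)); rewrite archi_boundP// ltW// divr_gt0.
exists n => m nm; have /andP[t0 t1] := threshold_itv m w01.
rewrite sub0r normrN ger0_norm//.
have v0 : 0 <= v by rewrite /v; lra.
have vm : 4 <= v ^+ m.
  have vE : v = 1 + d by rewrite /d; ring.
  have d1 : -1 <= d by lra.
  have h1 : 3 <= m%:R * d.
    by rewrite -ler_pdivrMr// (le_trans (ltW hn))// ler_nat.
  by rewrite vE; have := bernoulli_ineq m d1; lra.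
have big : 2 ^+ m <= (2 ^ (m * m - m))%:R * w ^+ (m * m).
  rewrite natrX -(ler_pM2r (x := 2 ^+ m)) ?exprn_gt0//.
  rewrite [leRHS]mulrAC -[X in _ <= X * _]exprD subnK; last first.
    by case: (m) => // k; rewrite leq_pmulr.
  rewrite -[leRHS]exprMn -/v exprM -[leLHS]exprMn lerXn2r ?nnegrE ?exprn_ge0//; rewrite ?mulr_ge0//; lra.
have y0 : 0 <= w ^+ (m * m) by rewrite exprn_ge0//; lra.
have y1 : w ^+ (m * m) <= 1 by rewrite exprn_ile1//; lra.
have ym1 : -1 <= w ^+ (m * m) by lra.
have h := bernoulli_ineq (2 ^ (m * m - m)) ym1.
rewrite ler_pdivlMr ?exprn_gt0//.
(* With y = w^(m m), (1 - y)^k (1 + y)^k = (1 - y^2)^k <= 1, while (1 + y)^k >= 1 + k y >= 2^m. *)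
apply: (@le_trans _ _ (threshold m w * (1 + w ^+ (m * m)) ^+ (2 ^ (m * m - m)))).
  by apply: ler_wpM2l => //; lra.
rewrite /threshold -exprMn exprn_ile1//.
  by rewrite mulr_ge0//; lra.
have := sqr_ge0 (w ^+ (m * m)); rewrite expr2; lra.
Qed.

Lemma threshold_cvg (w : R) : 0 <= w <= 1 ->
  threshold m w @[m --> \oo] --> ((w <= 2^-1)%R%:R : R).
Proof.
move=> /andP[w0 w1]; set l := (X in _ --> X).
have [m0 hm] : exists m0, forall m, (m0 <= m)%N -> `|l - threshold m w| <= 1 / 2 ^+ m.
  rewrite /l; case: leP => wh.
    by exists 0%N => m _; apply: threshold_le; rewrite w0.
  by apply: threshold_gt; rewrite wh.
apply/cvgrPdist_le => e e0.
have [n hn] : exists n : nat, 1 / e < n%:R.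
  by exists (Num.bound (1 / e)); rewrite archi_boundP// ltW// divr_gt0.
exists (maxn m0 n) => // m /=; rewrite geq_max => /andP[h1 h2].
apply: (le_trans (hm m h1)); rewrite ler_pdivrMr ?exprn_gt0//.
rewrite mulrC -ler_pdivrMr// (le_trans (ltW hn))// -natrX ler_nat.
by rewrite (leq_trans h2)// ltnW// ltn_expl.
Qed.

Lemma threshold_poly m (a b : R) : exists P : {poly R},
  forall x, P.[x] = threshold m (a * x + b).
Proof.
exists ((1 - (a%:P * 'X + b%:P) ^+ (m * m)) ^+ (2 ^ (m * m - m))) => x.
by rewrite !(hornerE, horner_exp).
Qed.

End ThresholdPolynomials.

(** * Cauchy transforms at large reals determine compactly supported measures *)

Section CauchyDeterminesMeasure.
Variable R : realType.
Local Notation C := R[i].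

Lemma Cauchy_dirac0 (mu : borelprob R) (z : C) :
  measure_equal mu (\d_ (0 : measurableTypeR R)) -> Cauchy mu z = z^-1.
Proof.
move=> h; have [m1 m2] := cmeasurable_resolvent z.
have int (f : R -> R) : measurable_fun [set: measurableTypeR R] f ->
    \int[mu]_x f x = f 0.
  move=> mf; rewrite /Rintegral.
  rewrite (@eq_measure_integral _ _ _ _ (\d_ (0 : measurableTypeR R))); last first.
    by move=> A mA _; exact: h.
  rewrite integral_dirac//; last exact/measurable_EFinP.
  by rewrite diracT mul1e.
by rewrite /Cauchy !int// subr0 complex_eta.
Qed.

Variables (mu nu : borelprob R) (M : R).
Local Notation D := (`[- M, M]%classic : set (measurableTypeR R)).
Hypothesis M0 : 0 < M.
Hypothesis muD : mu D = 1%E.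
Hypothesis nuD : nu D = 1%E.

Let mD : measurable D. Proof. exact: measurable_itv. Qed.

Let DM x : D x -> `|x| <= M. Proof. by rewrite /= in_itv/= ler_norml. Qed.

Lemma cmeasurable_poly (P : {poly R}) : cmeasurable (fun x => P.[x]%:C).
Proof.
elim/poly_ind: P => [|P c ih]; first by under eq_fun do rewrite horner0; exact: cmeasurable_cst.
under eq_fun do rewrite hornerMXaddC rmorphD rmorphM/=.
apply: cmeasurableD; last exact: cmeasurable_cst.
by apply: cmeasurableM => //; exact: cmeasurable_real.
Qed.

Lemma poly_bounded (P : {poly R}) : exists2 B : R, 0 <= B & forall x, D x -> `|P.[x]| <= B.
Proof.
elim/poly_ind: P => [|P c [B B0 ih]]; first by exists 0 => // x _; rewrite horner0 normr0.
exists (B * M + `|c|) => [|x Dx]; first by rewrite addr_ge0// mulr_ge0// ltW.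
rewrite hornerMXaddC (le_trans (ler_normD _ _))// lerD2r normrM.
by rewrite ler_pM// ?ih// DM.
Qed.

Let sep (y : R) : 2 * M <= y -> separated D y%:C (y / 2).
Proof.
move=> My; have y0 : 0 < y by apply: lt_le_trans My; rewrite mulr_gt0.
by have := @separated_itv _ y%:C M M0; rewrite nc_real gtr0_norm//; exact.
Qed.

Variable rho : R.
Hypothesis Cauchy_eq : forall y : R, rho <= y -> Cauchy mu y%:C = Cauchy nu y%:C.

Let T (m : borelprob R) (P : {poly R}) (y : R) : C :=
  cint m D (fun x => P.[x]%:C * (y%:C - x%:C)^-1).
Let I (m : borelprob R) (P : {poly R}) : C := cint m D (fun x => P.[x]%:C).

Let mT (P : {poly R}) y : cmeasurable (fun x => P.[x]%:C * (y%:C - x%:C)^-1).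
Proof. by apply: cmeasurableM; [exact: cmeasurable_poly|exact: cmeasurable_resolvent]. Qed.

Let bI (P : {poly R}) : cbounded D (fun x => P.[x]%:C).
Proof. by have [B _ h] := poly_bounded P; exists B => x /h; rewrite nc_real. Qed.

Let bT (P : {poly R}) y : 2 * M <= y ->
  cbounded D (fun x => P.[x]%:C * (y%:C - x%:C)^-1).
Proof.
move=> My; have [B B0 h] := poly_bounded P; exists (B * (y / 2)^-1) => x Dx.
by rewrite ncM ler_pM ?nc_ge0 ?(nc_resolvent (sep My))// nc_real h.
Qed.

(* [x p / (y - x) = y p / (y - x) - p]. *)
Let T_step (m : borelprob R) (P : {poly R}) (c y : R) : m D = 1%E -> 2 * M <= y ->
  T m (P * 'X + c%:P) y = y%:C * T m P y - I m P + c%:C * Cauchy m y%:C.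
Proof.
move=> h1 My; rewrite (Cauchy_cint mD h1) /T /I.
have mr := cmeasurable_resolvent y%:C.
have br : cbounded D (fun x : R => (y%:C - x%:C)^-1).
  by exists (y / 2)^-1 => x; apply: nc_resolvent; exact: sep.
have bZ c' f : cbounded D f -> cbounded D (fun x : R => c' * f x : C).
  by move=> [B hB]; exists (nc c' * B) => x /hB h; rewrite ncM ler_wpM2l ?nc_ge0.
have mc c' := cmeasurable_cst (c' : C).
have m1 := cmeasurableM (mc y%:C) (mT P y).
have m2 := cmeasurableM (mc c%:C) mr.
have b1 := bZ y%:C _ (bT P My).
have b2 := bZ c%:C _ br.
have m3 := cmeasurableD m1 (cmeasurableN (cmeasurable_poly P)).
have b3 : cbounded D (fun x : R => y%:C * (P.[x]%:C * (y%:C - x%:C)^-1) - P.[x]%:C).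
  have [B hB] := b1; have [B' hB'] := bI P; exists (B + B') => x Dx.
  by rewrite (le_trans (ncB _ _))// lerD ?hB ?hB'.
rewrite -(cintZ m mD y%:C (mT P y) (bT P My)) -(cintZ m mD c%:C mr br).
rewrite -(cintB m mD m1 (cmeasurable_poly P) b1 (bI P)) -(cintD m mD m3 m2 b3 b2).
apply: eq_cint => x Dx; have z0 := separated_neq0 (sep My) Dx.
rewrite hornerMXaddC rmorphD rmorphM/=.
by move: y%:C x%:C z0 => y' x' z0; field.
Qed.

(** By [T_step] with c = 0 the difference is the transform of [P * 'X], which is O(1/y); so y T(y)
    tends to the integral of P. *)
Let T_I (m : borelprob R) (P : {poly R}) : m D = 1%E -> exists2 B : R, 0 < B &
  forall y, 2 * M <= y -> nc (y%:C * T m P y - I m P) <= B / y.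
Proof.
move=> h1; have [B B0 hB] := poly_bounded (P * 'X).
exists (4 * B + 1) => [|y My]; first by rewrite ltr_wpDl// mulr_ge0.
have y0 : 0 < y by apply: lt_le_trans My; rewrite mulr_gt0.
have -> : y%:C * T m P y - I m P = T m (P * 'X + 0%:P) y.
  by rewrite T_step// rmorph0 mul0r addr0.
apply: (@le_trans _ _ (2 * (B / (y / 2)))).
  apply: nc_cint => // x Dx; rewrite addr0 ncM nc_real.
  by rewrite ler_pM ?nc_ge0 ?hB// (nc_resolvent (sep My)).
rewrite ler_pdivlMr//; have -> : 2 * (B / (y / 2)) * y = 4 * B by field; rewrite gt_eqF.
lra.
Qed.

Let I_eq (P : {poly R}) : (forall y, 2 * M <= y -> rho <= y -> T mu P y = T nu P y) ->
  I mu P = I nu P.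
Proof.
move=> h; have [B B0 h1] := T_I P muD; have [B' B'0 h2] := T_I P nuD.
apply: (@complex_eq_eps _ _ _ (B + B')) => [|e e0]; first by rewrite addr_gt0.
pose y := Num.max (2 * M) (Num.max rho e^-1).
have y1 : 2 * M <= y by rewrite le_max lexx.
have y2 : rho <= y by rewrite !le_max lexx orbT.
have y3 : e^-1 <= y by rewrite !le_max lexx !orbT.
have y0 : 0 < y by apply: lt_le_trans y1; rewrite mulr_gt0.
have ye : y^-1 <= e by rewrite -[leRHS]invrK lef_pV2 ?posrE ?invr_gt0.
have -> : I mu P - I nu P = (y%:C * T nu P y - I nu P) - (y%:C * T mu P y - I mu P).
  by rewrite h//; ring.
rewrite (le_trans (ncB _ _))// addrC mulrDl lerD//.
  by rewrite (le_trans (h1 y y1))// ler_wpM2l// ltW.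
by rewrite (le_trans (h2 y y1))// ler_wpM2l// ltW.
Qed.

(** Induction on P: equal transforms of P give equal integrals of P by letting y grow, and [T_step]
    then passes to [P * 'X + c%:P]. *)
Let T_eq (P : {poly R}) y : 2 * M <= y -> rho <= y -> T mu P y = T nu P y.
Proof.
elim/poly_ind: P y => [|P c ih] y y1 y2.
  have z m : T m 0 y = 0.
    rewrite /T (@eq_cint _ m D _ (fun=> 0)).
      by rewrite /cint !Rintegral_cst//= !mul0r.
    by move=> x _; rewrite horner0 mul0r.
  by rewrite !z.
by rewrite !T_step// (ih y y1 y2) (I_eq ih) Cauchy_eq.
Qed.

Lemma integral_poly_eq (P : {poly R}) :
  (\int[mu]_(x in D) (P.[x])%:E = \int[nu]_(x in D) (P.[x])%:E)%E.
Proof.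
have mP := (cmeasurable_poly P).1; have [B _ hB] := poly_bounded P.
have fin (m : borelprob R) : (\int[m]_(x in D) (P.[x])%:E)%E \is a fin_num.
  apply: integrable_fin_num => //; apply: measurable_bounded_integrable => //.
  - by rewrite -ge0_fin_numE ?measure_ge0// fin_num_measure.
  - exact: measurable_funTS.
  - exists B; split; first exact: num_real.
    by move=> y My x Dx; apply: le_trans (ltW My); exact: hB.
by rewrite -(fineK (fin mu)) -(fineK (fin nu)); congr (_%:E); case: (I_eq (fun y h1 h2 => T_eq P h1 h2)).
Qed.

Lemma measure_itv_eq (c : R) : mu `]-oo, c]%classic = nu `]-oo, c]%classic.
Proof.
(* The affine map w sends c to 1/2, and L is large enough for it to send [D] into [0, 1]. *)
pose L := 2 * (M + `|c|); have L0 : 0 < L by rewrite mulr_gt0// ltr_wpDr.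
pose w x := L^-1 * x + (2^-1 - L^-1 * c).
have w01 x : D x -> 0 <= w x <= 1.
  move=> /DM xM; have h : `|x - c| <= L / 2.
    by rewrite (le_trans (ler_normB _ _))// /L; lra.
  have -> : w x = (x - c) / L + 2^-1 by rewrite /w; field; rewrite gt_eqF.
  have : `|(x - c) / L| <= 2^-1.
    by rewrite normrM normfV [`|L|]gtr0_norm// ler_pdivrMr// mulrC.
  by rewrite ler_norml => /andP[]; lra.
pose A := `]-oo, c]%classic : set (measurableTypeR R).
have mA : measurable A by exact: measurable_itv.
have wc x : ((w x <= 2^-1)%R%:R : R) = \1_A x.
  rewrite indicE; congr (_%:R : R); congr nat_of_bool.
  have -> : (x \in A) = (x <= c) by rewrite mem_setE/= in_itv.
  rewrite /w addrCA -subr_ge0 opprD addrA subrr sub0r oppr_ge0 -mulrBr.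
  by rewrite pmulr_rle0 ?invr_gt0// subr_le0.
have lim (m : borelprob R) : (\int[m]_(x in D) (threshold n (w x))%:E)%E @[n --> \oo]
    --> m (A `&` D).
  rewrite -integral_indic//.
  have mth n : measurable_fun [set: measurableTypeR R] (fun x => threshold n (w x)).
    have c1 (k : R) : measurable_fun [set: measurableTypeR R] (cst k) by exact: measurable_cst.
    have mw : measurable_fun [set: measurableTypeR R] w.
      have mid : measurable_fun [set: measurableTypeR R] (fun x : R => x) by exact: measurable_id.
      exact: (measurable_funD (measurable_funM (c1 L^-1) mid) (c1 (2^-1 - L^-1 * c))).
    exact: (measurable_funX _ (measurable_funB (c1 1) (measurable_funX _ mw))).
  have := @dominated_cvg _ _ _ m D mD (fun n x => (threshold n (w x))%:E)
    (fun x => (\1_A x)%:E) (cst 1%E).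
  apply.
  - move=> n; have h : measurable_fun D (EFin \o (fun x => threshold n (w x))).
      by apply/measurable_EFinP; exact: measurable_funTS.
    exact: h.
  - move=> x Dx; apply/cvg_EFin; first exact: nearW.
    by rewrite -wc; exact: threshold_cvg (w01 x Dx).
  - by [].
  - exact: finite_measure_integrable_cst.
  - move=> n x Dx; rewrite /= lee_fin; have /andP[h1 h2] := threshold_itv n (w01 x Dx).
    by rewrite ger0_norm.
have conc (m : borelprob R) : m D = 1%E -> m A = m (A `&` D).
  move=> h; have mDc : measurable (~` D) by exact: measurableC.
  have z : m (~` D) = 0%E by rewrite probability_setC// h subee.
  rewrite -[in LHS](setIT A) -(setUv D) setIUr measureU//; [|exact: measurableI|exact: measurableI|].
    by rewrite [X in (_ + X)%E](_ : _ = 0%E) ?adde0//;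
      apply: (subset_measure0 _ _ _ z) => //; exact: measurableI.
  by rewrite setIACA setICr setI0.
rewrite -/A (conc _ muD) (conc _ nuD).
have e : (fun n => \int[mu]_(x in D) (threshold n (w x))%:E)%E =
    (fun n => \int[nu]_(x in D) (threshold n (w x))%:E)%E.
  apply/funext => n; have [P hP] := threshold_poly n L^-1 (2^-1 - L^-1 * c).
  under eq_integral do rewrite -[threshold _ _]hP.
  under [RHS]eq_integral do rewrite -[threshold _ _]hP.
  exact: integral_poly_eq.
have lmu := lim mu; rewrite e in lmu.
exact: (cvg_unique _ lmu (lim nu)).
Qed.

Lemma Cauchy_determines_measure : measure_equal mu nu.
Proof.
move=> A mA; have hA : (@RGenOInfty.G R).-sigma.-measurable A.
  by rewrite -RGenOInfty.measurableE.
apply: (@g_sigma_algebra_measure_unique _ R (measurableTypeR R) (@RGenOInfty.G R) _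
  (fun n : nat => `]- n%:R, +oo[%classic)) hA => //.
- by move=> _ [x ->]; exact: measurable_itv.
- by move=> n; exists (- n%:R).
- rewrite -subTset => x _; exists (Num.bound `|x|) => //=; rewrite in_itv/= andbT.
  by have := archi_boundP (normr_ge0 x); rewrite ltr_norml => /andP[].
- move=> _ _ [x ->] [y ->]; exists (Num.max x y).
  by apply/seteqP; split => z /=; rewrite !in_itv/= !andbT gt_max => /andP.
- move=> _ [x ->].
  have tail (m : borelprob R) : m `]x, +oo[%classic = (1 - m `]-oo, x]%classic)%E.
    by rewrite -setCitvl probability_setC//; exact: measurable_itv.
  by apply: (etrans (tail mu)); rewrite measure_itv_eq; exact/esym/tail.
- by move=> k; rewrite -ge0_fin_numE ?measure_ge0// fin_num_measure.
Qed.

End CauchyDeterminesMeasure.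

(** * The R-transform determines the measure; uniqueness of free convolution *)

Section RTransformUniqueness.
Variable R : realType.
Local Notation C := R[i].
Implicit Types mu nu : borelprob R.

Lemma concentrated_widen mu (M M' : R) : M <= M' ->
  mu `[- M, M]%classic = 1%E -> mu `[- M', M']%classic = 1%E.
Proof.
move=> MM' h; apply/eqP; rewrite eq_le probability_le1/=; last exact: measurable_itv.
rewrite -h le_measure ?inE; [by []|exact: measurable_itv|exact: measurable_itv|].
by apply: subset_itv; rewrite bnd_simp// lerN2.
Qed.

(** For large z the value u of the first Cauchy transform is small, so it is also a value of the
    second one, at some z'. Equal R-transforms give z u - 1 = z' u - 1, whence z = z'. *)
Lemma Rtransform_determines_measure mu nu : P0 mu -> P0 nu ->
  (\forall z \near (0 : R[i]^o), Rtransform mu z = Rtransform nu z) ->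
  measure_equal mu nu.
Proof.
move=> hmu hnu /near0P[d d0 hR]; have h00 : 0 <= (0 : R) <= 0 by rewrite lexx.
have [r1 r10 h1] := Rtransform_Cauchy 0 hmu.
have [r2 r20 h2] := Rtransform_Cauchy 0 hnu.
have [lip tends] := Cauchy_lip_infty 0 hnu.
have [d' d'0 surj] := surjective_near0 (g := fun _ => Cauchy nu) lip tends r2 h00.
have [lE _] := Cauchy_lip_infty 0 hmu.
have [K K0 [r3 r30 h3]] := lip_infty_bounded lE.
pose rho := Num.max (Num.max r1 r3) ((K + 1) / Num.min d d').
have key z : rho <= nc z -> Cauchy mu z = Cauchy nu z.
  rewrite !ge_max => /andP[/andP[z1 z3] zd].
  have [G0 RG] := h1 0 z h00 z1; set u := Cauchy mu z in G0 RG *.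
  have small : nc u < Num.min d d'.
    have dd : 0 < Num.min d d' by rewrite lt_min d0.
    have z0 : 0 < nc z by exact: lt_le_trans z1.
    have := h3 0 z h00 z3; rewrite ncM -/u => h.
    rewrite ltNge; apply/negP => du.
    have : (K + 1) <= nc z * nc u.
      by rewrite (le_trans _ (ler_wpM2l (ltW z0) du))// -ler_pdivrMr.
    by lra.
  move: small; rewrite lt_min => /andP[ud ud'].
  have [|z' z'2 uz'] := surj u; first by rewrite nc_gt0 G0.
  have [_ RG'] := h2 0 z' h00 z'2; move: RG'; rewrite uz' -hR// RG => /addIr/(mulIf G0) zz'.
  by rewrite zz' uz'.
have [M M0 muM] := P0_concentrated hmu; have [M' M'0 nuM'] := P0_concentrated hnu.
apply: (@Cauchy_determines_measure R mu nu (Num.max M M') _ _ _ (Num.max rho 0)).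
- by rewrite lt_max M0.
- by apply: concentrated_widen muM; rewrite le_max lexx.
- by apply: concentrated_widen nuM'; rewrite le_max lexx orbT.
- move=> y; rewrite ge_max => /andP[y1 y2].
  by apply: key; rewrite nc_real ger0_norm.
Qed.

Lemma Rtransform_dirac0 mu : P0 mu ->
  measure_equal mu (\d_ (0 : measurableTypeR R)) ->
  \forall z \near (0 : R[i]^o), Rtransform mu z = 0.
Proof.
move=> hmu hd; have [lip tends] := Cauchy_lip_infty 0 hmu.
apply: (near0_of_infty (g := fun _ => Cauchy mu) (lexx 0) lip tends); first exact: Rtransform0.
apply: near_infty_imp (near_inftyI (near_infty_neq0 0) (Rtransform_Cauchy 0 hmu)).
by move=> s z _ [z0 [_ ->]]; rewrite Cauchy_dirac0// divff// subrr.
Qed.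

(** [free_conv] is some measure picked by [xget]; any measure with the required R-transform agrees
    with it because R-transforms determine measures. *)
Lemma free_conv_unique mu nu rho : is_free_conv mu nu rho ->
  measure_equal rho (free_conv mu nu).
Proof.
move=> h; have [hrho Rrho] := h.
have [hconv Rconv] : is_free_conv mu nu (free_conv mu nu).
  exact: (@xgetI _ mu [set r | is_free_conv mu nu r] rho).
apply: Rtransform_determines_measure => //; near=> z.
by rewrite (near Rrho z)// (near Rconv z).
Unshelve. all: by end_near. Qed.

End RTransformUniqueness.

Theorem theorem1p1 (R : realType) (lambda : R) (lambda_ge0 : 0 <= lambda) :
  (forall w w0 : R -> borelprob R,
     is_process (@P0 R) (@pde_w R) w ->
     is_fundamental (@P0 R) (@pde_w R) w0 ->
     forall t : R, 0 <= t ->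
       [/\ \forall z \near (0 : R[i]^o),
             Rtransform (w t) z = Rtransform (w 0) z + Rtransform (w0 t) z,
           \forall z \near (0 : R[i]^o),
             Rtransform (w0 t) z = t%:C * z ^+ 2
         & measure_equal (w t) (free_conv (w 0) (w0 t))])
  /\
  (forall m m0 : R -> borelprob R,
     is_process (@P0_nonneg R) (pde_m lambda) m ->
     is_fundamental (@P0_nonneg R) (pde_m lambda) m0 ->
     forall t : R, 0 <= t ->
       (\forall z \near (0 : R[i]^o),
          Rtransform (m t) z =
            1 / (1 - t%:C * z) * Rtransform (m 0) (z / (1 - t%:C * z))
            + Rtransform (m0 t) z)
       /\
       (\forall z \near (0 : R[i]^o),
          Rtransform (m0 t) z = lambda%:C * t%:C * z / (1 - t%:C * z)))
  /\
  (forall wl wl0 : R -> borelprob R,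
     is_process (@P0_sym R) (pde_wl lambda) wl ->
     is_fundamental (@P0_sym R) (pde_wl lambda) wl0 ->
     forall t : R, 0 <= t ->
       (\forall z \near (0 : R[i]^o),
          Rtransform (wl t) z
          + (1 - lambda%:C) * t%:C * z ^+ 2 / (Rtransform (wl t) z + 1) =
            Rtransform (wl0 t) z
            + (1 - lambda%:C) * t%:C * z ^+ 2 / (Rtransform (wl0 t) z + 1)
            + Rtransform (wl 0)
                (z * sqrtc (1 - (1 - lambda%:C) *
                       ((Rtransform (wl t) z + 1)^-1
                        - (Rtransform (wl t) z + 1 - t%:C * z ^+ 2)^-1))))
       /\
       (\forall z \near (0 : R[i]^o),
          Rtransform (wl0 t) z =
            1 / 2 * (- 1 + t%:C * z ^+ 2
                     + sqrtc (1 + 2 * (2 * lambda%:C - 1) * t%:C * z ^+ 2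
                              + t%:C ^+ 2 * z ^+ 4)))).
Proof.
split; [|split].
- move=> w w0 [hP _ pde] [[hP0 _ pde0] delta] t t0.
  have P00 := hP0 0 (lexx 0).
  have Rw := Rtransform_pde_w t0 (hP 0 (lexx 0)) (hP t t0) pde.
  have Rw0 : \forall z \near (0 : R[i]^o), Rtransform (w0 t) z = t%:C * z ^+ 2.
    have h1 := Rtransform_pde_w t0 P00 (hP0 t t0) pde0.
    have h2 := Rtransform_dirac0 P00 delta.
    by near=> z; rewrite (near h1 z)// (near h2 z)// add0r.
  have Rsum : \forall z \near (0 : R[i]^o),
      Rtransform (w t) z = Rtransform (w 0) z + Rtransform (w0 t) z.
    by near=> z; rewrite (near Rw z)// (near Rw0 z).
  split => //; apply: free_conv_unique; split => //; exact: hP.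
- move=> m m0 [hP _ pde] [[hP0 _ pde0] delta] t t0.
  have PP s : 0 <= s -> P0 (m s) by move=> /hP[].
  have PP0 s : 0 <= s -> P0 (m0 s) by move=> /hP0[].
  have P00 := PP0 0 (lexx 0).
  have Rm := Rtransform_pde_m t0 (PP 0 (lexx 0)) (PP t t0) pde.
  have Rm0 : \forall z \near (0 : R[i]^o),
      Rtransform (m0 t) z = lambda%:C * t%:C * z / (1 - t%:C * z).
    have h1 := Rtransform_pde_m t0 P00 (PP0 t t0) pde0.
    have /near0P[d d0 h2] := Rtransform_dirac0 P00 delta.
    have /near0P[d' d'0 h1'] := h1.
    (* The last bound gives |t z| <= 1/2, so z/(1 - t z) has modulus at most 2|z|, which stays below
       d. *)
    apply/near0P; exists (Num.min d' (Num.min (d / 2) (2^-1 / (t + 1)))).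
      by rewrite !lt_min d'0 !divr_gt0// ltr_wpDl.
    move=> z; rewrite !lt_min => /and3P[z1 z2 z3]; rewrite h1'// h2 ?mulr0 ?add0r//.
    have tz : nc (t%:C * z) <= 2^-1.
      rewrite ncM nc_real ger0_norm//.
      move: z3; rewrite ltr_pdivlMr ?ltr_wpDl// => z3.
      by have := nc_ge0 z; lra.
    have den : 2^-1 <= nc (1 - t%:C * z).
      by have := ler_ncB 1 (t%:C * z); rewrite nc1; lra.
    rewrite ncM ncV ltr_pdivrMr ?(lt_le_trans _ den) ?invr_gt0//.
    by apply: (lt_le_trans z2); rewrite ler_wpM2l// ltW.
  split => //; near=> z.
  by rewrite (near Rm z)// (near Rm0 z).
- move=> wl wl0 [hP _ pde] [[hP0 _ pde0] delta] t t0.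
  have PP s : 0 <= s -> P0 (wl s) by move=> /hP[].
  have PP0 s : 0 <= s -> P0 (wl0 s) by move=> /hP0[].
  have P00 := PP0 0 (lexx 0).
  have Rwl := Rtransform_pde_wl t0 (PP 0 (lexx 0)) (PP t t0) pde.
  have Ginv z : Cauchy (wl0 0) z = z^-1 by apply: Cauchy_dirac0.
  have Rwl0 := Rtransform_pde_wl_fundamental t0 P00 (PP0 t t0) pde0 Ginv.
  (* The closed form is a root of R (R + 1) + (1 - lambda) t z^2 = t z^2 (R + 1), whose discriminant
     is the radicand. *)
  have quadratic : \forall z \near (0 : R[i]^o), Rtransform (wl0 t) z
      + (1 - lambda%:C) * t%:C * z ^+ 2 / (Rtransform (wl0 t) z + 1) = t%:C * z ^+ 2.
    have /near0P[d d0 h] := Rwl0.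
    apply/near0P; exists (Num.min d (Num.min 1 (2^-1 / (t + 1)))).
      by rewrite !lt_min d0 ltr01 divr_gt0// ltr_wpDl.
    move=> z; rewrite !lt_min => /and3P[z1 z2 z3]; rewrite h//.
    set x := sqrtc _; have xx : x ^+ 2 = 1 + 2 * (2 * lambda%:C - 1) * t%:C * z ^+ 2
      + t%:C ^+ 2 * z ^+ 4 by exact: sqr_sqrtc.
    have Rex : 0 <= complex.Re x := Re_sqrtc_ge0 _.
    have tz : nc (1 + t%:C * z ^+ 2 - 1) <= 2^-1.
      rewrite addrC addKr ncM ncX nc_real ger0_norm//.
      move: z3; rewrite ltr_pdivlMr ?ltr_wpDl// => z3.
      have zz : nc z ^+ 2 <= nc z by rewrite expr2 ler_piMr ?nc_ge0// ltW.
      by have := nc_ge0 z; have := ler_wpM2l t0 zz; lra.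
    (* This is 2 (R + 1); 1 + t z^2 has positive real part and the principal root x a nonnegative
       one. *)
    have Y0 : 1 + t%:C * z ^+ 2 + x != 0.
      apply/eqP => /(congr1 (@complex.Re R)); rewrite ReD /= => Y0.
      by have := Re_near1 tz; lra.
    have -> : 1 / 2 * (- 1 + t%:C * z ^+ 2 + x) + 1 = (1 + t%:C * z ^+ 2 + x) / 2 by field.
    apply: (mulfI Y0); apply/eqP; rewrite -subr_eq0; apply/eqP.
    transitivity ((x ^+ 2 - (1 + 2 * (2 * lambda%:C - 1) * t%:C * z ^+ 2
      + t%:C ^+ 2 * z ^+ 4)) / 2); first by field.
    by rewrite xx subrr mul0r.
  split => //; near=> u.
  by rewrite (near Rwl u)// (near quadratic u).
Unshelve. all: by end_near.
Qed.
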